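(* Let $(E,C)$ be a separated graph, $K$ a commutative unital ring with involution, and $S$ a subset of $C^{\mathrm{fin}}$. Let $p=\sum_{v\in E^0}v$ (a multiplier projection of the Leavitt path algebras of $(E_S,C^S)$). Then there is a natural $*$-isomorphism $$\overline\varphi\colon CL_K^{\mathrm{ab}}(E,C,S)\cong p\,\mathcal L_K^{\mathrm{ab}}(E_S,C^S)\,p$$ such that $\overline\varphi(v)=v$ for all $v\in E^0$ and $\overline\varphi(e)=e$ for all $e\in E^1$. In particular (taking $S=\emptyset$ and writing $(\overline E,\overline C)=(E_\emptyset,C^\emptyset)$), $\mathcal C_K^{\mathrm{ab}}(E,C)\cong p\,\mathcal L_K^{\mathrm{ab}}(\overline E,\overline C)\,p$.
   Context: A directed graph $E=(E^0,E^1,s,r)$ has arbitrary sets of vertices and edges and source/range maps $s,r$. A separated graph $(E,C)$ is a directed graph with $C=\bigsqcup_{v\in E^0}C_v$, where $C_v$ is a partition of $s^{-1}(v)$ into pairwise disjoint nonempty subsets ($C_v=\emptyset$ if $s^{-1}(v)=\emptyset$). $C^{\mathrm{fin}}=\{X\in C:|X|<\infty\}$ and $C^{\mathrm{fin}}_v=C^{\mathrm{fin}}\cap C_v$. For $S\subseteq C^{\mathrm{fin}}$, the Cohn–Leavitt path algebra $CL_K(E,C,S)$ is the universal $*$-algebra over $K$ generated by self-adjoint elements $v\in E^0$ and elements $e\in E^1$ subject to: $vw=\delta_{v,w}v$; $s(e)e=e=er(e)$; $e^*s(e)=e^*=r(e)e^*$; $e^*f=\delta_{e,f}r(e)$ for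 $e,f\in X$, $X\in C$; and $\sum_{e\in X}ee^*=v$ for every $X\in S\cap C_v$, $v\in E^0$. The Cohn path algebra is $\mathcal C_K(E,C)=CL_K(E,C,\emptyset)$ and the Leavitt path algebra is $\mathcal L_K(E,C)=CL_K(E,C,C^{\mathrm{fin}})$. The tame versions $CL_K^{\mathrm{ab}}$, $\mathcal C_K^{\mathrm{ab}}$, $\mathcal L_K^{\mathrm{ab}}$ are the quotients by the two-sided ideal generated by all commutators $[xx^*,yy^*]$, with $x,y$ in the multiplicative $*$-subsemigroup generated by the vertices and edges. The separated graph $(E_S,C^S)$: $(E_S)^0=E^0\sqcup\{v_X:X\in C^{\mathrm{fin}}\setminus S\}$, $(E_S)^1=E^1\sqcup\{d_X:X\in C^{\mathrm{fin}}\setminus S\}$; $s,r$ extend those of $E$, and $s(d_X)=v$, $r(d_X)=v_X$ for $X\in C^{\mathrm{fin}}_v\setminus S$. Its separation is $C^S_v=\{\overline X:X\in C_v\}$ for $v\in E^0$, where $\overline X=X\cup\{d_X\}$ if $X\in C^{\mathrm{fin}}\setminus S$ and $\overline X=X$ otherwise (the $v_X$ are sinks). For an algebra $A$ generated by the vertices and edges of $E_S$ and their adjoints, $pAp$ denotes the linear span of all $vAw$ with $v,w\in E^0$. *)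

(* Defs.v *)
From HB Require Import structures.
From mathcomp Require Import all_boot ssralg generic_quotient ring_quotient.
From mathcomp Require Import boolp classical_sets functions cardinality fsbigop.

Set Implicit Arguments.
Unset Strict Implicit.
Unset Printing Implicit Defensive.

Import GRing.Theory.

Local Open Scope classical_set_scope.
Local Open Scope quotient_scope.
Local Open Scope ring_scope.

Declare Scope star_scope.
Delimit Scope star_scope with star.
Local Open Scope star_scope.

HB.mixin Record isInvolutiveRing K of GRing.ComPzRing K := {
  kstar : K -> K;
  kstarD : {morph kstar : x y / x + y};
  kstarM : {morph kstar : x y / x * y};
  kstarK : involutive kstar
}.

#[short(type="comStarRingType")]
HB.structure Definition ComStarRing :=
  {K of GRing.ComPzRing K & isInvolutiveRing K}.

(* No unit is required: the path algebra of a graph with infinitely many      *)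
(* vertices has none.                                                         *)
HB.mixin Record Lmodule_isStarAlgebra (K : comStarRingType) A
    of GRing.Lmodule K A := {
  smul : A -> A -> A;
  star : A -> A;
  smulA : associative smul;
  smulDl : left_distributive smul +%R;
  smulDr : right_distributive smul +%R;
  smulZl : forall k x y, smul (k *: x) y = k *: smul x y;
  smulZr : forall k x y, smul x (k *: y) = k *: smul x y;
  starD : {morph star : x y / x + y};
  starZ : forall k x, star (k *: x) = kstar k *: star x;
  starM : forall x y, star (smul x y) = smul (star y) (star x);
  starK : involutive star
}.

#[short(type="starAlgType")]
HB.structure Definition StarAlgebra (K : comStarRingType) :=
  {A of GRing.Lmodule K A & Lmodule_isStarAlgebra K A}.

Notation "x ** y" := (smul x y) (at level 40, left associativity) : star_scope.
Notation "x ^*" := (star x) : star_scope.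

Definition star_morphism (K : comStarRingType) (A B : starAlgType K)
    (f : A -> B) : Prop :=
  [/\ linear f, {morph f : x y / x ** y} & {morph f : x / x^*}].

Definition star_isomorphism (K : comStarRingType) (A B : starAlgType K)
    (f : A -> B) : Prop :=
  star_morphism f /\ bijective f.

Section StarAlgebraTheory.
Variables (K : comStarRingType) (A : starAlgType K).
Implicit Types (x y : A) (k : K).

Lemma smul0l x : 0 ** x = 0.
Proof. by rewrite -[X in X ** _](scale0r (0 : A)) smulZl scale0r. Qed.

Lemma smul0r x : x ** 0 = 0.
Proof. by rewrite -[X in _ ** X](scale0r (0 : A)) smulZr scale0r. Qed.

Lemma smulNl x y : (- x) ** y = - (x ** y).
Proof. by rewrite -scaleN1r smulZl scaleN1r. Qed.

Lemma smulNr x y : x ** (- y) = - (x ** y).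
Proof. by rewrite -scaleN1r smulZr scaleN1r. Qed.

Lemma smulBl x y z : (x - y) ** z = x ** z - y ** z.
Proof. by rewrite smulDl smulNl. Qed.

Lemma smulBr x y z : z ** (x - y) = z ** x - z ** y.
Proof. by rewrite smulDr smulNr. Qed.

Lemma star0 : (0 : A)^* = 0.
Proof. by apply: (addrI (0 : A)^*); rewrite -starD !addr0. Qed.

Lemma starN x : (- x)^* = - x^*.
Proof. by apply/eqP; rewrite -addr_eq0 -starD addNr star0. Qed.

Lemma starB x y : (x - y)^* = x^* - y^*.
Proof. by rewrite starD starN. Qed.

End StarAlgebraTheory.

Section Closures.
Variables (K : comStarRingType) (A : starAlgType K).
Implicit Types I M G : set A.

Definition submodule M : Prop :=
  M 0 /\ forall (k : K) x y, M x -> M y -> M (k *: x + y).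

Definition two_sided_ideal I : Prop :=
  [/\ submodule I, forall a x, I x -> I (a ** x) & forall a x, I x -> I (x ** a)].

Definition star_closed M : Prop := forall x, M x -> M x^*.

Definition star_subsemigroup M : Prop :=
  (forall x y, M x -> M y -> M (x ** y)) /\ star_closed M.

Definition span G : set A := smallest submodule G.

Definition ideal_gen G : set A := smallest two_sided_ideal G.

Definition star_ideal_gen G : set A :=
  smallest (fun I => two_sided_ideal I /\ star_closed I) G.

Definition star_semigroup_gen G : set A := smallest star_subsemigroup G.

Definition commutator (x y : A) : A := x ** y - y ** x.

Definition tame_commutators G : set A :=
  [set commutator (x ** x^*) (y ** y^*) |
     x in star_semigroup_gen G & y in star_semigroup_gen G].

Lemma span_submodule G : submodule (span G).
Proof.
split=> [I [[? _] _]//|k x y Mx My I [sI GI]].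
by apply: sI.2; [apply: Mx|apply: My].
Qed.

Lemma ideal_gen_ideal G : two_sided_ideal (ideal_gen G).
Proof.
split; first split.
- by move=> I [[[]]].
- move=> k x y Ix Iy I iI; have [[[_ h] _ _] _] := iI.
  by exact: h (Ix I iI) (Iy I iI).
- by move=> a x Ix I iI; have [[_ h _] _] := iI; exact: h (Ix I iI).
- by move=> a x Ix I iI; have [[_ _ h] _] := iI; exact: h (Ix I iI).
Qed.

Lemma ideal_gen_star G : star_closed G -> star_closed (ideal_gen G).
Proof.
move=> sG x Ix; have [[I0 IL] Il Ir] := ideal_gen_ideal G.
apply: (Ix [set y | ideal_gen G y^*]); split=> [|y Gy]; last first.
  by apply: sub_gen_smallest; apply: sG.
split=> /=; first split=> /=.
- by rewrite star0.
- by move=> k y z Iy Iz; rewrite starD starZ; apply: IL.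
- by move=> a y Iy; rewrite starM; apply: Ir.
- by move=> a y Iy; rewrite starM; apply: Il.
Qed.

Lemma star_ideal_gen_ideal G : two_sided_ideal (star_ideal_gen G).
Proof.
split; first split.
- by move=> I [[[[]]]].
- move=> k x y Ix Iy I iI; have [[[[_ h] _ _] _] _] := iI.
  by exact: h (Ix I iI) (Iy I iI).
- by move=> a x Ix I iI; have [[[_ h _] _] _] := iI; exact: h (Ix I iI).
- by move=> a x Ix I iI; have [[[_ _ h] _] _] := iI; exact: h (Ix I iI).
Qed.

Lemma star_ideal_gen_star G : star_closed (star_ideal_gen G).
Proof. by move=> x Ix I iI; have [[_ h] _] := iI; exact: h (Ix I iI). Qed.

Lemma tame_commutators_star G : star_closed (tame_commutators G).
Proof.
move=> _ [x Gx [y Gy <-]]; exists y => //; exists x => //.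
by rewrite /commutator starB !starM !starK.
Qed.

End Closures.

Record starIdeal (K : comStarRingType) (A : starAlgType K) := StarIdeal {
  starIdeal_set :> set A;
  starIdeal_ideal : two_sided_ideal starIdeal_set;
  starIdeal_star : star_closed starIdeal_set
}.

Section StarQuotient.
Variables (K : comStarRingType) (A : starAlgType K) (I : starIdeal A).

Definition starIdeal_pred : {pred A} := fun x => `[< starIdeal_set I x >].

Lemma starIdeal_zmod_closed : zmod_closed starIdeal_pred.
Proof.
have [[I0 IL] _ _] := starIdeal_ideal I.
split=> [|x y /asboolP Ix /asboolP Iy]; apply/asboolP => //.
by rewrite addrC -scaleN1r; apply: IL.
Qed.

HB.instance Definition _ :=
  GRing.isZmodClosed.Build A starIdeal_pred starIdeal_zmod_closed.

Definition starQuot := Quotient.quot starIdeal_pred.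
HB.instance Definition _ := GRing.Zmodule.on starQuot.

Definition quot_pi (x : A) : starQuot := \pi_(Quotient.quot starIdeal_pred) x.

Lemma quot_piP x y : quot_pi x = quot_pi y <-> starIdeal_set I (x - y).
Proof.
split=> [/eqP|Ixy]; last apply/eqP.
  by rewrite /quot_pi -Quotient.idealrBE => /asboolP.
by rewrite /quot_pi -Quotient.idealrBE; apply/asboolP.
Qed.

Lemma quot_pi_repr (q : starQuot) : quot_pi (repr q) = q.
Proof. exact: reprK. Qed.

Lemma quot_reprP x : starIdeal_set I (repr (quot_pi x) - x).
Proof. by apply/quot_piP; rewrite quot_pi_repr. Qed.

Lemma quot_piD : {morph quot_pi : x y / x + y}.
Proof. exact: (raddfD (\pi_(Quotient.quot starIdeal_pred))). Qed.

Definition quot_scale (k : K) (q : starQuot) : starQuot := quot_pi (k *: repr q).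
Definition quot_mul (q r : starQuot) : starQuot := quot_pi (repr q ** repr r).
Definition quot_star (q : starQuot) : starQuot := quot_pi (repr q)^*.

Lemma quot_piZ k x : quot_pi (k *: x) = quot_scale k (quot_pi x).
Proof.
have [[I0 IL] _ _] := starIdeal_ideal I.
by apply/esym/quot_piP; rewrite -scalerBr -[_ *: _]addr0; apply/IL/I0/quot_reprP.
Qed.

Lemma quot_piM x y : quot_pi (x ** y) = quot_mul (quot_pi x) (quot_pi y).
Proof.
have [[I0 IL] Il Ir] := starIdeal_ideal I.
apply/esym/quot_piP; set x' := repr _; set y' := repr _.
rewrite -(subrK (x ** y') (x' ** y')) -addrA -smulBl -smulBr -[X in X + _]scale1r.
by apply: IL; [apply/Ir/quot_reprP|apply/Il/quot_reprP].
Qed.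

Lemma quot_piS x : quot_pi x^* = quot_star (quot_pi x).
Proof.
by apply/esym/quot_piP; rewrite -starB; apply/starIdeal_star/quot_reprP.
Qed.

Lemma quotW (P : starQuot -> Prop) : (forall x, P (quot_pi x)) -> forall q, P q.
Proof. by move=> h q; rewrite -(quot_pi_repr q). Qed.

Fact quot_scalerA a b q : quot_scale a (quot_scale b q) = quot_scale (a * b) q.
Proof. by elim/quotW: q => x; rewrite -!quot_piZ scalerA. Qed.
Fact quot_scale1r : left_id 1 quot_scale.
Proof. by elim/quotW => x; rewrite -quot_piZ scale1r. Qed.
Fact quot_scalerDr : right_distributive quot_scale +%R.
Proof.
by move=> k; elim/quotW => x; elim/quotW => y; rewrite -quot_piD -!quot_piZ
  -quot_piD scalerDr.
Qed.
Fact quot_scalerDl q : {morph quot_scale^~ q : a b / a + b}.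
Proof.
by move=> a b; elim/quotW: q => x; rewrite -!quot_piZ -quot_piD scalerDl.
Qed.

HB.instance Definition _ := GRing.Zmodule_isLmodule.Build K starQuot
  quot_scalerA quot_scale1r quot_scalerDr quot_scalerDl.

Fact quot_mulA : associative quot_mul.
Proof.
by elim/quotW=> x; elim/quotW=> y; elim/quotW=> z; rewrite -!quot_piM smulA.
Qed.
Fact quot_mulDl : left_distributive quot_mul +%R.
Proof.
by elim/quotW=> x; elim/quotW=> y; elim/quotW=> z;
  rewrite -quot_piD -!quot_piM -quot_piD smulDl.
Qed.
Fact quot_mulDr : right_distributive quot_mul +%R.
Proof.
by elim/quotW=> x; elim/quotW=> y; elim/quotW=> z;
  rewrite -quot_piD -!quot_piM -quot_piD smulDr.
Qed.
Fact quot_mulZl k q r : quot_mul (k *: q) r = k *: quot_mul q r.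
Proof.
by elim/quotW: q => x; elim/quotW: r => y;
  rewrite -[k *: _]quot_piZ -!quot_piM -[RHS]quot_piZ smulZl.
Qed.
Fact quot_mulZr k q r : quot_mul q (k *: r) = k *: quot_mul q r.
Proof.
by elim/quotW: q => x; elim/quotW: r => y;
  rewrite -[k *: _]quot_piZ -!quot_piM -[RHS]quot_piZ smulZr.
Qed.
Fact quot_starD : {morph quot_star : q r / q + r}.
Proof.
by elim/quotW=> x; elim/quotW=> y; rewrite -quot_piD -!quot_piS -quot_piD starD.
Qed.
Fact quot_starZ k q : quot_star (k *: q) = kstar k *: quot_star q.
Proof.
by elim/quotW: q => x; rewrite -[k *: _]quot_piZ -!quot_piS -[RHS]quot_piZ starZ.
Qed.
Fact quot_starM q r : quot_star (quot_mul q r) = quot_mul (quot_star r) (quot_star q).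
Proof.
by elim/quotW: q => x; elim/quotW: r => y;
  rewrite -quot_piM -!quot_piS -quot_piM starM.
Qed.
Fact quot_starK : involutive quot_star.
Proof. by elim/quotW=> x; rewrite -!quot_piS starK. Qed.

HB.instance Definition _ := Lmodule_isStarAlgebra.Build K starQuot
  quot_mulA quot_mulDl quot_mulDr quot_mulZl quot_mulZr
  quot_starD quot_starZ quot_starM quot_starK.

Lemma quot_pi_morphism : star_morphism quot_pi.
Proof.
split=> [k x y|x y|x]; last exact: quot_piS; last exact: quot_piM.
by rewrite quot_piD quot_piZ.
Qed.

End StarQuotient.

Lemma quot_lift (K : comStarRingType) (A B : starAlgType K) (I : starIdeal A)
    (f : A -> B) : star_morphism f -> (forall x, starIdeal_set I x -> f x = 0) ->
  exists g : starQuot I -> B, star_morphism g /\ forall x, g (quot_pi I x) = f x.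
Proof.
move=> [fL fM fS] fI; pose g (q : starQuot I) := f (repr q).
have fD x y : f (x + y) = f x + f y by rewrite -[x]scale1r fL !scale1r.
have gE x : g (quot_pi I x) = f x.
  by rewrite /g -[repr _](subrK x) fD fI ?add0r//; apply: quot_reprP.
have [pL pM pS] := quot_pi_morphism I.
exists g; split=> //; split.
- by move=> k; elim/quotW=> x; elim/quotW=> y; rewrite -pL !gE fL.
- by elim/quotW=> x; elim/quotW=> y; rewrite -pM !gE fM.
- by elim/quotW=> x; rewrite -pS !gE fS.
Qed.

Inductive sterm (K G : Type) : Type :=
| SGen of G
| SZero
| SAdd of sterm K G & sterm K G
| SScale of K & sterm K G
| SMul of sterm K G & sterm K G
| SStar of sterm K G.

Arguments SGen {K G}.
Arguments SZero {K G}.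

HB.instance Definition _ (K G : Type) := gen_eqMixin (sterm K G).
HB.instance Definition _ (K G : Type) := gen_choiceMixin (sterm K G).

(* The least congruence on terms modulo which the laws of star-algebras hold. *)
Inductive sterm_eq (K : comStarRingType) (G : Type) :
    sterm K G -> sterm K G -> Prop :=
| st_refl a : sterm_eq a a
| st_sym a b : sterm_eq a b -> sterm_eq b a
| st_trans b a c : sterm_eq a b -> sterm_eq b c -> sterm_eq a c
| st_add a a' b b' : sterm_eq a a' -> sterm_eq b b' ->
    sterm_eq (SAdd a b) (SAdd a' b')
| st_scale k a a' : sterm_eq a a' -> sterm_eq (SScale k a) (SScale k a')
| st_mul a a' b b' : sterm_eq a a' -> sterm_eq b b' ->
    sterm_eq (SMul a b) (SMul a' b')
| st_star a a' : sterm_eq a a' -> sterm_eq (SStar a) (SStar a')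
| st_addA a b c : sterm_eq (SAdd a (SAdd b c)) (SAdd (SAdd a b) c)
| st_addC a b : sterm_eq (SAdd a b) (SAdd b a)
| st_add0 a : sterm_eq (SAdd SZero a) a
| st_addN a : sterm_eq (SAdd (SScale (-1) a) a) SZero
| st_scaleA k l a : sterm_eq (SScale k (SScale l a)) (SScale (k * l) a)
| st_scale1 a : sterm_eq (SScale 1 a) a
| st_scaleDr k a b :
    sterm_eq (SScale k (SAdd a b)) (SAdd (SScale k a) (SScale k b))
| st_scaleDl k l a :
    sterm_eq (SScale (k + l) a) (SAdd (SScale k a) (SScale l a))
| st_mulA a b c : sterm_eq (SMul a (SMul b c)) (SMul (SMul a b) c)
| st_mulDl a b c : sterm_eq (SMul (SAdd a b) c) (SAdd (SMul a c) (SMul b c))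
| st_mulDr a b c : sterm_eq (SMul a (SAdd b c)) (SAdd (SMul a b) (SMul a c))
| st_mulZl k a b : sterm_eq (SMul (SScale k a) b) (SScale k (SMul a b))
| st_mulZr k a b : sterm_eq (SMul a (SScale k b)) (SScale k (SMul a b))
| st_starD a b : sterm_eq (SStar (SAdd a b)) (SAdd (SStar a) (SStar b))
| st_starZ k a : sterm_eq (SStar (SScale k a)) (SScale (kstar k) (SStar a))
| st_starM a b : sterm_eq (SStar (SMul a b)) (SMul (SStar b) (SStar a))
| st_starK a : sterm_eq (SStar (SStar a)) a.

Section Free.
Variables (K : comStarRingType) (G : Type).
Local Notation term := (sterm K G).

Definition sterm_eqb (a b : term) : bool := `[< sterm_eq a b >].

Lemma sterm_eqb_equiv : equiv_class_of sterm_eqb.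
Proof.
split=> [a|a b|b a c].
- by apply/asboolP; exact: st_refl.
- by apply/asboolP/asboolP; exact: st_sym.
- by move=> /asboolP ab /asboolP bc; apply/asboolP; exact: st_trans ab bc.
Qed.

Canonical sterm_equiv := EquivRelPack sterm_eqb_equiv.

Definition free : Type := {eq_quot sterm_eqb}.
HB.instance Definition _ := Choice.on free.

Definition free_pi (a : term) : free := \pi_({eq_quot sterm_eqb}) a.
Definition free_repr (x : free) : term := @repr _ {eq_quot sterm_eqb} x.

Lemma free_piP a b : free_pi a = free_pi b <-> sterm_eq a b.
Proof.
split=> [/eqmodP/asboolP//|ab].
by apply/eqmodP/asboolP.
Qed.

Lemma free_pi_repr x : free_pi (free_repr x) = x.
Proof. exact: reprK. Qed.

Lemma free_reprP a : sterm_eq (free_repr (free_pi a)) a.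
Proof. by apply/free_piP; rewrite free_pi_repr. Qed.

Lemma freeW (P : free -> Prop) : (forall a, P (free_pi a)) -> forall x, P x.
Proof. by move=> h x; rewrite -(free_pi_repr x). Qed.

Definition free_gen (g : G) : free := free_pi (SGen g).
Definition free_zero : free := free_pi SZero.
Definition free_add x y : free := free_pi (SAdd (free_repr x) (free_repr y)).
Definition free_scale k x : free := free_pi (SScale k (free_repr x)).
Definition free_opp x : free := free_scale (-1) x.
Definition free_mul x y : free := free_pi (SMul (free_repr x) (free_repr y)).
Definition free_star x : free := free_pi (SStar (free_repr x)).

Lemma free_piD a b : free_add (free_pi a) (free_pi b) = free_pi (SAdd a b).
Proof. by apply/free_piP/st_add; apply: free_reprP. Qed.
Lemma free_piZ k a : free_scale k (free_pi a) = free_pi (SScale k a).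
Proof. by apply/free_piP/st_scale; apply: free_reprP. Qed.
Lemma free_piM a b : free_mul (free_pi a) (free_pi b) = free_pi (SMul a b).
Proof. by apply/free_piP/st_mul; apply: free_reprP. Qed.
Lemma free_piS a : free_star (free_pi a) = free_pi (SStar a).
Proof. by apply/free_piP/st_star; apply: free_reprP. Qed.

Let piE := (free_piD, free_piZ, free_piM, free_piS).

Fact free_addA : associative free_add.
Proof.
elim/freeW=> a; elim/freeW=> b; elim/freeW=> c; rewrite !piE.
exact/free_piP/st_addA.
Qed.
Fact free_addC : commutative free_add.
Proof.
by elim/freeW=> a; elim/freeW=> b; rewrite !piE; exact/free_piP/st_addC.
Qed.
Fact free_add0 : left_id free_zero free_add.
Proof. by elim/freeW=> a; rewrite !piE; exact/free_piP/st_add0. Qed.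
Fact free_addN : left_inverse free_zero free_opp free_add.
Proof. by elim/freeW=> a; rewrite /free_opp !piE; exact/free_piP/st_addN. Qed.

HB.instance Definition _ :=
  GRing.isZmodule.Build free free_addA free_addC free_add0 free_addN.

Fact free_scalerA k l x : free_scale k (free_scale l x) = free_scale (k * l) x.
Proof. by elim/freeW: x => a; rewrite !piE; exact/free_piP/st_scaleA. Qed.
Fact free_scale1r : left_id 1 free_scale.
Proof. by elim/freeW => a; rewrite !piE; exact/free_piP/st_scale1. Qed.
Fact free_scalerDr : right_distributive free_scale +%R.
Proof.
move=> k; elim/freeW=> a; elim/freeW=> b; rewrite /GRing.add/= !piE.
exact/free_piP/st_scaleDr.
Qed.
Fact free_scalerDl x : {morph free_scale^~ x : k l / k + l}.
Proof.
move=> k l; elim/freeW: x => a; rewrite [in RHS]/GRing.add/= !piE.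
exact/free_piP/st_scaleDl.
Qed.

HB.instance Definition _ := GRing.Zmodule_isLmodule.Build K free
  free_scalerA free_scale1r free_scalerDr free_scalerDl.

Fact free_mulA : associative free_mul.
Proof.
elim/freeW=> a; elim/freeW=> b; elim/freeW=> c; rewrite !piE.
exact/free_piP/st_mulA.
Qed.
Fact free_mulDl : left_distributive free_mul +%R.
Proof.
elim/freeW=> a; elim/freeW=> b; elim/freeW=> c; rewrite /GRing.add/= !piE.
exact/free_piP/st_mulDl.
Qed.
Fact free_mulDr : right_distributive free_mul +%R.
Proof.
elim/freeW=> a; elim/freeW=> b; elim/freeW=> c; rewrite /GRing.add/= !piE.
exact/free_piP/st_mulDr.
Qed.
Fact free_mulZl k x y : free_mul (k *: x) y = k *: free_mul x y.
Proof.
elim/freeW: x => a; elim/freeW: y => b; rewrite /GRing.scale/= !piE.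
exact/free_piP/st_mulZl.
Qed.
Fact free_mulZr k x y : free_mul x (k *: y) = k *: free_mul x y.
Proof.
elim/freeW: x => a; elim/freeW: y => b; rewrite /GRing.scale/= !piE.
exact/free_piP/st_mulZr.
Qed.
Fact free_starD : {morph free_star : x y / x + y}.
Proof.
elim/freeW=> a; elim/freeW=> b; rewrite /GRing.add/= !piE.
exact/free_piP/st_starD.
Qed.
Fact free_starZ k x : free_star (k *: x) = kstar k *: free_star x.
Proof.
elim/freeW: x => a; rewrite /GRing.scale/= !piE.
exact/free_piP/st_starZ.
Qed.
Fact free_starM x y :
  free_star (free_mul x y) = free_mul (free_star y) (free_star x).
Proof.
elim/freeW: x => a; elim/freeW: y => b; rewrite !piE.
exact/free_piP/st_starM.
Qed.
Fact free_starK : involutive free_star.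
Proof. by elim/freeW=> a; rewrite !piE; exact/free_piP/st_starK. Qed.

HB.instance Definition _ := Lmodule_isStarAlgebra.Build K free
  free_mulA free_mulDl free_mulDr free_mulZl free_mulZr
  free_starD free_starZ free_starM free_starK.

Fixpoint sterm_eval (B : starAlgType K) (f : G -> B) (a : term) : B :=
  match a with
  | SGen g => f g
  | SZero => 0
  | SAdd a b => sterm_eval f a + sterm_eval f b
  | SScale k a => k *: sterm_eval f a
  | SMul a b => sterm_eval f a ** sterm_eval f b
  | SStar a => (sterm_eval f a)^*
  end.

Lemma sterm_eval_eq (B : starAlgType K) (f : G -> B) a b :
  sterm_eq a b -> sterm_eval f a = sterm_eval f b.
Proof.
elim=> //=.
- by move=> ? ? ? _ -> _ ->.
- by move=> ? ? ? ? _ -> _ ->.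
- by move=> ? ? ? _ ->.
- by move=> ? ? ? ? _ -> _ ->.
- by move=> ? ? _ ->.
- by move=> *; rewrite addrA.
- by move=> *; rewrite addrC.
- by move=> *; rewrite add0r.
- by move=> *; rewrite scaleN1r addNr.
- by move=> *; rewrite scalerA.
- by move=> *; rewrite scale1r.
- by move=> *; rewrite scalerDr.
- by move=> *; rewrite scalerDl.
- by move=> *; rewrite smulA.
- by move=> *; rewrite smulDl.
- by move=> *; rewrite smulDr.
- by move=> *; rewrite smulZl.
- by move=> *; rewrite smulZr.
- by move=> *; rewrite starD.
- by move=> *; rewrite starZ.
- by move=> *; rewrite starM.
- by move=> *; rewrite starK.
Qed.

Lemma free_universal (B : starAlgType K) (f : G -> B) :
  exists! F : free -> B, star_morphism F /\ forall g, F (free_gen g) = f g.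
Proof.
pose F (x : free) := sterm_eval f (free_repr x).
have FE a : F (free_pi a) = sterm_eval f a by exact/sterm_eval_eq/free_reprP.
have DE a b : free_pi a + free_pi b = free_pi (SAdd a b) by exact: free_piD.
have ZE k a : k *: free_pi a = free_pi (SScale k a) by exact: free_piZ.
have ME a b : free_pi a ** free_pi b = free_pi (SMul a b) by exact: free_piM.
have SE a : (free_pi a)^* = free_pi (SStar a) by exact: free_piS.
exists F; split.
  split; last by move=> g; rewrite FE.
  split.
  - by move=> k; elim/freeW=> a; elim/freeW=> b; rewrite ZE DE !FE.
  - by elim/freeW=> a; elim/freeW=> b; rewrite ME !FE.
  - by elim/freeW=> a; rewrite SE !FE.
move=> F' [[FL FM FS] Fg]; apply/funext; elim/freeW=> a; rewrite FE.
have F0 : F' 0 = 0.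
  by have := FL (-1) 0 0; rewrite addr0 scaler0 scaleN1r addNr.
elim: a => [g||a iha b ihb|k a iha|a iha b ihb|a iha] /=.
- by rewrite -Fg.
- by rewrite -F0.
- by rewrite iha ihb -DE -[X in F' (X + _)]scale1r FL scale1r.
- by rewrite iha -ZE -[X in _ = F' X]addr0 FL F0 addr0.
- by rewrite iha ihb -ME FM.
- by rewrite iha -SE FS.
Qed.

End Free.

Record subStarAlg (K : comStarRingType) (A : starAlgType K) := SubStarAlg {
  subStarAlg_set :> set A;
  subStarAlg_submod : submodule subStarAlg_set;
  subStarAlg_semigroup : star_subsemigroup subStarAlg_set
}.

Section SubStarAlg.
Variables (K : comStarRingType) (A : starAlgType K) (B : subStarAlg A).

Definition subalg_pred : {pred A} := fun x => `[< subStarAlg_set B x >].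

Lemma subalg_predP x : reflect (subStarAlg_set B x) (x \in subalg_pred).
Proof. exact: asboolP. Qed.

Lemma subalg_submod_closed : submod_closed subalg_pred.
Proof.
have [B0 BL] := subStarAlg_submod B.
split=> [|k x y /asboolP Bx /asboolP By]; apply/asboolP => //.
exact: BL.
Qed.

HB.instance Definition _ :=
  GRing.isSubmodClosed.Build K A subalg_pred subalg_submod_closed.

Record subalg : Type := Subalg { subalg_val : A; _ : subalg_val \in subalg_pred }.

HB.instance Definition _ := [isSub for subalg_val].
HB.instance Definition _ := [Choice of subalg by <:].
HB.instance Definition _ := [SubChoice_isSubLmodule of subalg by <:].

Fact subalg_mul_subproof (x y : subalg) : val x ** val y \in subalg_pred.
Proof.
have [BM _] := subStarAlg_semigroup B.
by apply/subalg_predP/BM; apply/subalg_predP; exact: valP.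
Qed.
Fact subalg_star_subproof (x : subalg) : (val x)^* \in subalg_pred.
Proof.
have [_ BS] := subStarAlg_semigroup B.
by apply/subalg_predP/BS; apply/subalg_predP; exact: valP.
Qed.

Definition subalg_mul (x y : subalg) : subalg := Subalg (subalg_mul_subproof x y).
Definition subalg_star (x : subalg) : subalg := Subalg (subalg_star_subproof x).

Fact subalg_mulA : associative subalg_mul.
Proof. by move=> x y z; apply: val_inj; exact: smulA. Qed.
Fact subalg_mulDl : left_distributive subalg_mul +%R.
Proof. by move=> x y z; apply: val_inj; rewrite /= smulDl. Qed.
Fact subalg_mulDr : right_distributive subalg_mul +%R.
Proof. by move=> x y z; apply: val_inj; rewrite /= smulDr. Qed.
Fact subalg_mulZl k x y : subalg_mul (k *: x) y = k *: subalg_mul x y.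
Proof. by apply: val_inj; rewrite /= smulZl. Qed.
Fact subalg_mulZr k x y : subalg_mul x (k *: y) = k *: subalg_mul x y.
Proof. by apply: val_inj; rewrite /= smulZr. Qed.
Fact subalg_starD : {morph subalg_star : x y / x + y}.
Proof. by move=> x y; apply: val_inj; rewrite /= starD. Qed.
Fact subalg_starZ k x : subalg_star (k *: x) = kstar k *: subalg_star x.
Proof. by apply: val_inj; rewrite /= starZ. Qed.
Fact subalg_starM x y :
  subalg_star (subalg_mul x y) = subalg_mul (subalg_star y) (subalg_star x).
Proof. by apply: val_inj; exact: starM. Qed.
Fact subalg_starK : involutive subalg_star.
Proof. by move=> x; apply: val_inj; exact: starK. Qed.

HB.instance Definition _ := Lmodule_isStarAlgebra.Build K subalg
  subalg_mulA subalg_mulDl subalg_mulDr subalg_mulZl subalg_mulZr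
  subalg_starD subalg_starZ subalg_starM subalg_starK.

End SubStarAlg.

(* [pAp] for the formal sum [p] of a family of self-adjoint elements [v i]    *)
Section Corner.
Variables (K : comStarRingType) (A : starAlgType K) (I : Type) (v : I -> A).
Hypothesis v_sa : forall i, (v i)^* = v i.

Definition corner_set : set A :=
  span [set x | exists i a j, x = v i ** a ** v j].

Lemma corner_submod : submodule corner_set.
Proof. exact: span_submodule. Qed.

Lemma corner_semigroup : star_subsemigroup corner_set.
Proof.
have [c0 cL] := corner_submod.
split=> [x y cx cy|x cx]; last first.
  apply: (cx [set x | corner_set x^*]); split=> [|_ [i [a [j ->]]]] /=.
    split=> /= [|k y z cy cz]; first by rewrite star0.
    by rewrite starD starZ; exact: cL.
  apply: sub_gen_smallest; exists j, a^*, i.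
  by rewrite !starM !v_sa smulA.
apply: (cx [set x | corner_set (x ** y)]); split=> [|_ [i [a [j ->]]]] /=.
  split=> /= [|k x1 x2 c1 c2]; first by rewrite smul0l.
  by rewrite smulDl smulZl; exact: cL.
apply: (cy [set y | corner_set (v i ** a ** v j ** y)]).
split=> [|_ [i' [b [j' ->]]]] /=.
  split=> /= [|k y1 y2 c1 c2]; first by rewrite smul0r.
  by rewrite smulDr smulZr; exact: cL.
apply: sub_gen_smallest; exists i, (a ** v j ** v i' ** b), j'.
by rewrite !smulA.
Qed.

Definition corner : subStarAlg A := SubStarAlg corner_submod corner_semigroup.

End Corner.

(* Vertices and edges form arbitrary sets: every type is a choiceType by      *)
(* [gen_eqMixin] and [gen_choiceMixin].                                       *)
Record sepGraph := SepGraph {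
  vertex : choiceType;
  edge : choiceType;
  src : edge -> vertex;
  rng : edge -> vertex;
  sep : vertex -> set (set edge);
  sepP : forall v, partition (sep v) id (src @^-1` [set v])
}.

Arguments src {s}.
Arguments rng {s}.
Arguments sep {s}.

Definition colour {E : sepGraph} : set (set (edge E)) := \bigcup_v sep v.

Definition colour_fin {E : sepGraph} : set (set (edge E)) :=
  colour `&` [set X | finite_set X].

(* The relations of the Cohn-Leavitt path algebra of (E, C, S), for arbitrary  *)
(* elements [v_ v] and [e_ e] of a star-algebra.                              *)
Inductive CL_rel (K : comStarRingType) (E : sepGraph) (S : set (set (edge E)))
    (A : starAlgType K) (v_ : vertex E -> A) (e_ : edge E -> A) :
    A -> A -> Prop :=
| CL_vv v w : CL_rel S v_ e_ (v_ v ** v_ w) (if v == w then v_ v else 0)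
| CL_vstar v : CL_rel S v_ e_ (v_ v)^* (v_ v)
| CL_se e : CL_rel S v_ e_ (v_ (src e) ** e_ e) (e_ e)
| CL_er e : CL_rel S v_ e_ (e_ e ** v_ (rng e)) (e_ e)
| CL_es e : CL_rel S v_ e_ ((e_ e)^* ** v_ (src e)) (e_ e)^*
| CL_re e : CL_rel S v_ e_ (v_ (rng e) ** (e_ e)^*) (e_ e)^*
| CL_ef X e f : colour X -> X e -> X f ->
    CL_rel S v_ e_ ((e_ e)^* ** e_ f) (if e == f then v_ (rng e) else 0)
| CL_sum v X : S X -> sep v X ->
    CL_rel S v_ e_ (\sum_(e \in X) (e_ e ** (e_ e)^*)) (v_ v).

Section PathAlgebra.
Variables (K : comStarRingType) (E : sepGraph) (S : set (set (edge E))).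

Local Notation F := (free K (vertex E + edge E)).
Let v_ (v : vertex E) : F := free_gen K (inl v).
Let e_ (e : edge E) : F := free_gen K (inr e).

Definition CL_ideal : starIdeal F :=
  let R := [set x | exists a b, CL_rel S v_ e_ a b /\ x = a - b] in
  StarIdeal (star_ideal_gen_ideal R) (@star_ideal_gen_star _ _ R).

Definition CL : starAlgType K := starQuot CL_ideal.

Definition CL_vertex (v : vertex E) : CL := quot_pi CL_ideal (v_ v).
Definition CL_edge (e : edge E) : CL := quot_pi CL_ideal (e_ e).

Lemma CL_relP a b : CL_rel S v_ e_ a b ->
  quot_pi CL_ideal a = quot_pi CL_ideal b.
Proof.
by move=> ab; apply/quot_piP; apply: sub_gen_smallest; exists a, b.
Qed.

Lemma CL_universal (B : starAlgType K) (p : vertex E -> B) (q : edge E -> B) :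
  S `<=` colour_fin -> (forall a b, CL_rel S p q a b -> a = b) ->
  exists! f : CL -> B, [/\ star_morphism f,
    forall v, f (CL_vertex v) = p v & forall e, f (CL_edge e) = q e].
Proof.
move=> Sfin pq.
pose h (g : vertex E + edge E) := match g with inl v => p v | inr e => q e end.
have [f [[fm fg] fu]] := free_universal h.
have [fL fM fS] := fm.
have f0 : f 0 = 0.
  by have := fL (-1) 0 0; rewrite addr0 scaler0 scaleN1r addNr.
have fD x y : f (x + y) = f x + f y by rewrite -[x]scale1r fL !scale1r.
have fN x : f (- x) = - f x.
  by apply/eqP; rewrite -addr_eq0 -fD addNr f0.
have fR a b : CL_rel S v_ e_ a b -> f a = f b.
  case=> [v w|v|e|e|e|e|X e e' CX Xe Xe'|v X SX vX].
  - rewrite fM !fg (pq _ _ (CL_vv S p q v w)).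
    by case: ifP; rewrite ?fg.
  - by rewrite fS fg (pq _ _ (CL_vstar S p q v)).
  - by rewrite fM !fg (pq _ _ (CL_se S p q e)).
  - by rewrite fM !fg (pq _ _ (CL_er S p q e)).
  - by rewrite fM fS !fg (pq _ _ (CL_es S p q e)).
  - by rewrite fM fS !fg (pq _ _ (CL_re S p q e)).
  - rewrite fM fS !fg (pq _ _ (CL_ef S p q CX Xe Xe')).
    by case: ifP; rewrite ?fg.
  - have [_ Xfin] := Sfin _ SX.
    rewrite fg -[h _](pq _ _ (CL_sum p q SX vX)) !fsbig_finite//=.
    by rewrite (big_morph f fD f0); apply: eq_bigr => e _; rewrite fM fS fg.
have [|g [gm gf]] := @quot_lift K F B CL_ideal f fm.
  move=> x Ix; apply: (Ix [set x | f x = 0]); split=> [|_ [a [b [ab ->]]]] /=.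
    split; last by move=> y /= y0; rewrite fS y0 star0.
    split; first split=> //=.
    - by move=> k y z /= y0 z0; rewrite fL y0 z0 scaler0 addr0.
    - by move=> a y /= y0; rewrite fM y0 smul0r.
    - by move=> a y /= y0; rewrite fM y0 smul0l.
  by rewrite fD fN (fR _ _ ab) subrr.
exists g; split; first by split=> // z; rewrite gf fg.
move=> g' [g'm g'p g'q]; apply/funext; elim/quotW=> x; rewrite gf.
have [g'L g'M g'S] := g'm; have [pL pM pS] := quot_pi_morphism CL_ideal.
suff -> : f = g' \o quot_pi CL_ideal by [].
apply: fu; split; last by case=> z /=; [exact: g'p|exact: g'q].
split=> [k y z|y z|y] /=; first by rewrite pL g'L.
- by rewrite pM g'M.
- by rewrite pS g'S.
Qed.

Definition CLab_ideal : starIdeal CL :=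
  let T := tame_commutators (range CL_vertex `|` range CL_edge) in
  StarIdeal (ideal_gen_ideal T) (ideal_gen_star (@tame_commutators_star _ _ _)).

Definition CLab : starAlgType K := starQuot CLab_ideal.

Definition CLab_vertex (v : vertex E) : CLab := quot_pi CLab_ideal (CL_vertex v).
Definition CLab_edge (e : edge E) : CLab := quot_pi CLab_ideal (CL_edge e).

Lemma CLab_vertex_star v : (CLab_vertex v)^* = CLab_vertex v.
Proof.
have [_ _ pS] := quot_pi_morphism CLab_ideal; rewrite -pS; congr quot_pi.
have [_ _ qS] := quot_pi_morphism CL_ideal; rewrite -qS.
exact/CL_relP/CL_vstar.
Qed.

End PathAlgebra.

Definition cohn_ab (K : comStarRingType) (E : sepGraph) : starAlgType K :=
  CLab K (set0 : set (set (edge E))).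

Definition leavitt_ab (K : comStarRingType) (E : sepGraph) : starAlgType K :=
  CLab K (@colour_fin E).

Section GraphES.
Variables (E : sepGraph) (S : set (set (edge E))).

Local Notation newX := (set_type (colour_fin `\` S)).

Lemma newX_sep (X : newX) : exists v, sep v (val X).
Proof. by have [[[v _ vX] _] _] := set_mem (valP X); exists v. Qed.

(* Unique, as the elements of the [sep v] are nonempty and have disjoint      *)
(* unions for distinct [v].                                                   *)
Definition colour_src (X : newX) : vertex E := sval (cid (newX_sep X)).

Definition ES_src (e : edge E + newX) : vertex E + newX :=
  match e with inl e => inl (src e) | inr X => inl (colour_src X) end.

Definition ES_rng (e : edge E + newX) : vertex E + newX :=
  match e with inl e => inl (rng e) | inr X => inr X end.

(* [inr Y] is [d_Y], so the second set is [{d_X}] if [X] is in [C^fin \ S]    *)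
(* and empty otherwise.                                                       *)
Definition ES_bar (X : set (edge E)) : set (edge E + newX) :=
  inl @` X `|` inr @` [set Y : newX | val Y = X].

Definition ES_sep (v : vertex E + newX) : set (set (edge E + newX)) :=
  match v with inl v => ES_bar @` sep v | inr _ => set0 end.

Lemma sep_nonempty (v : vertex E) (X : set (edge E)) : sep v X -> X !=set0.
Proof. by have [_ _ h] := sepP v; exact: h. Qed.

Lemma sep_src (v : vertex E) (X : set (edge E)) (e : edge E) :
  sep v X -> X e -> src e = v.
Proof.
move=> vX Xe; have [h _ _] := sepP v.
by have : (src @^-1` [set v]) e by rewrite -h; exists X.
Qed.

Lemma sep_inj (v w : vertex E) (X : set (edge E)) : sep v X -> sep w X -> v = w.
Proof.
move=> vX wX; have [e Xe] := sep_nonempty vX.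
by rewrite -(sep_src vX Xe) (sep_src wX Xe).
Qed.

Lemma colour_srcP (X : newX) : sep (colour_src X) (val X).
Proof. exact: (svalP (cid (newX_sep X))). Qed.

Lemma ES_sepP v : partition (ES_sep v) id (ES_src @^-1` [set v]).
Proof.
case: v => [v|X]; last first.
  split=> [|? ? []|? []].
  by rewrite /cover bigcup_set0; apply/seteqP; split=> // -[].
have [cE tE nE] := sepP v; split.
- apply/seteqP; split=> [_ [_ [X vX <-]] [[e Xe <-]|[Y /= YX <-]]|[e|Y]] /=.
  + by rewrite (sep_src vX Xe).
  + by congr inl; move: vX; rewrite -YX; exact: sep_inj (colour_srcP Y).
  + case=> ev; have : (src @^-1` [set v]) e by [].
    rewrite -cE => -[X vX /= Xe]; exists (ES_bar X); first by exists X.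
    by left; exists e.
  + case=> Yv; exists (ES_bar (val Y)); last by right; exists Y.
    by exists (val Y) => //; rewrite -Yv; exact: colour_srcP.
- move=> _ _ [X vX <-] [Y vY <-] [[e|Z] []] /=.
  + case=> [[e1 Xe1 [e1e]]|[? _ //]] [[e2 Ye2 [e2e]]|[? _ //]]; subst e1 e2.
    by rewrite (tE X Y)//; exists e.
  + by case=> [[? _ //]|[Z1 /= Z1X [Z1Z]]] [[? _ //]|[Z2 /= Z2X [Z2Z]]];
      subst Z1 Z2; rewrite -Z1X -Z2X.
- move=> _ [X vX <-]; have [e Xe] := sep_nonempty vX.
  by exists (inl e); left; exists e.
Qed.

Definition ES : sepGraph :=
  @SepGraph (vertex E + newX)%type (edge E + newX)%type ES_src ES_rng ES_sep
    ES_sepP.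

End GraphES.

Definition leavitt_corner (K : comStarRingType) (E : sepGraph)
    (S : set (set (edge E))) : subStarAlg (leavitt_ab K (ES S)) :=
  @corner K (leavitt_ab K (ES S)) (vertex E)
    (fun v => CLab_vertex K (@colour_fin (ES S)) (inl v))
    (fun v => CLab_vertex_star K (@colour_fin (ES S)) (inl v)).

(* Main.v *)
(* The universal property gives phi : CL^ab(E,C,S) -> L^ab(E_S,C^S), with     *)
(* values in the corner.  Surjectivity: d_X d_X^* is the gap                  *)
(* v - \sum_(e in X) e e^*, and v_X emits no edge, so a product of generators *)
(* between old vertices meets new edges only in pairs d_X d_X^* and collapses *)
(* to a value of phi.  Injectivity: let q_X be the gap of X in                *)
(* A = CL^ab(E,C,S).  In matrices over A with one old index 0 and one index   *)
(* per X, sending v, e, d_X, v_X to v E_00, e E_00, q_X E_0X, q_X E_XX        *)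
(* satisfies the relations of L^ab(E_S,C^S), and the composite with phi is    *)
(* a |-> a E_00.                                                              *)

Require Import Defs.
From HB Require Import structures.
From mathcomp Require Import all_boot ssralg.
From mathcomp Require Import boolp classical_sets functions cardinality fsbigop.

Local Open Scope classical_set_scope.

Set Implicit Arguments.
Unset Strict Implicit.
Unset Printing Implicit Defensive.

Import GRing.Theory.

Local Open Scope ring_scope.
Local Open Scope star_scope.

(** Both halves of bijectivity rest on the gap q_X of a finite colour X outside S: the map [phi],
    obtained from the universal property [CLab_lift], sends q_X to d_X d_X^* ([phi_gap]).

    Injectivity needs a representation of L^ab(E_S,C^S) from which the elements of A can be read
    off. The matrices satisfy the graph relations ([ES_matrix_rel]) because q_X is a projection
    orthogonal to the edges of X which completes the sum of the e e^* to v. The delicate point is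
    tameness ([ES_matrix_tame]), since q_X need not be a word in the generators. The ranges u u^* of
    words, however, span a commutative algebra ([range_spanC], [range_spanM]) containing q_X.
    Elements whose ranges lie in this algebra and which conjugate it into itself, together with
    their adjoints, form a star-semigroup with commuting ranges, and this semigroup contains all
    matrix entries that occur.

    For surjectivity, the products of an image of [phi] with an old vertex or a new edge span a set
    stable under right multiplication ([N_T_mul]). Cutting by an old vertex on the right kills the
    terms that end in some d_X, so only images of [phi] remain ([corner_sub_range]). *)

(** * Star-morphisms and generated star-semigroups *)

Section StarMorphism.
Variables (K : comStarRingType) (A B : starAlgType K) (f : A -> B).
Hypothesis fm : star_morphism f.

Lemma star_morphism0 : f 0 = 0.
Proof.
have [fL _ _] := fm.
by have := fL (-1) 0 0; rewrite addr0 scaler0 scaleN1r addNr.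
Qed.

Lemma star_morphismD x y : f (x + y) = f x + f y.
Proof. by have [fL _ _] := fm; rewrite -[x]scale1r fL !scale1r. Qed.

Lemma star_morphismB x y : f (x - y) = f x - f y.
Proof.
have [fL _ _] := fm.
by rewrite [x - y]addrC -scaleN1r fL scaleN1r addrC.
Qed.

Lemma star_morphism_fsum (T : choiceType) (X : set T) (F : T -> A) :
  finite_set X -> f (\sum_(t \in X) F t) = \sum_(t \in X) f (F t).
Proof.
move=> Xfin; rewrite !fsbig_finite//.
exact: (big_morph f star_morphismD star_morphism0).
Qed.

Lemma star_semigroup_gen_morphism (G : set A) (H : set B) x :
  (forall g, G g -> H (f g)) ->
  star_semigroup_gen G x -> star_semigroup_gen H (f x).
Proof.
have [_ fM fS] := fm; move=> GH Gx.
apply: (Gx [set x | star_semigroup_gen H (f x)]).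
split=> [|g /GH Hg] /=; last exact: sub_gen_smallest.
split=> [a b fa fb|a fa] /= N NH; have [[NM NS] _] := NH.
  by rewrite fM; apply: NM; [apply: fa|apply: fb].
by rewrite fS; apply: NS; apply: fa.
Qed.

(** Used to pull words of the tame quotient back to [CL], where the defining commutators live. *)
Lemma star_semigroup_gen_lift (G : set A) (H : set B) y :
  (forall h, H h -> exists2 g, G g & f g = h) ->
  star_semigroup_gen H y -> exists2 x, star_semigroup_gen G x & f x = y.
Proof.
have [_ fM fS] := fm; move=> HG Hy.
apply: (Hy [set y | exists2 x, star_semigroup_gen G x & f x = y]).
split=> [|h /HG [g Gg gh]] /=; last by exists g => //; apply: sub_gen_smallest.
split=> [_ _ [a Ga <-] [b Gb <-]|_ [a Ga <-]] /=.
  exists (a ** b); last by rewrite fM.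
  move=> N NG; have [[NM _] _] := NG.
  by apply: NM; [apply: Ga|apply: Gb].
exists a^*; last by rewrite fS.
by move=> N NG; have [[_ NS] _] := NG; apply: NS; apply: Ga.
Qed.

Lemma star_morphism_commutator x y :
  f (commutator x y) = commutator (f x) (f y).
Proof. by have [_ fM _] := fm; rewrite star_morphismB !fM. Qed.

End StarMorphism.

Lemma star_morphism_comp (K : comStarRingType) (A B C : starAlgType K)
    (f : A -> B) (g : B -> C) :
  star_morphism f -> star_morphism g -> star_morphism (g \o f).
Proof.
move=> [fL fM fS] [gL gM gS].
by split=> [k x y|x y|x] /=; rewrite ?fL ?fM ?fS ?gL ?gM ?gS.
Qed.

(** * Relations, induction and universal property of the tame algebra *)

Section Relations.
Variables (K : comStarRingType) (E : sepGraph) (S : set (set (edge E))).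
Hypothesis Sfin : S `<=` colour_fin.

(** Only the images under [f] are assumed equal, so that quotient maps qualify although the
    relations may fail upstairs. Finiteness of the colours in S lets [f] pass through the sums. *)
Lemma CL_rel_morphism (A B : starAlgType K) (f : A -> B)
    (p : vertex E -> A) (q : edge E -> A) :
  star_morphism f -> (forall a b, CL_rel S p q a b -> f a = f b) ->
  forall a b, CL_rel S (f \o p) (f \o q) a b -> a = b.
Proof.
move=> fm pq a b; have [_ fM fS] := fm.
case=> [v w|v|e|e|e|e|X e e' CX Xe Xe'|v X SX vX] /=.
- by rewrite -fM (pq _ _ (CL_vv S p q v w)); case: ifP; rewrite ?star_morphism0.
- by rewrite -fS (pq _ _ (CL_vstar S p q v)).
- by rewrite -fM (pq _ _ (CL_se S p q e)).
- by rewrite -fM (pq _ _ (CL_er S p q e)).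
- by rewrite -fS -fM (pq _ _ (CL_es S p q e)).
- by rewrite -fS -fM (pq _ _ (CL_re S p q e)).
- rewrite -fS -fM (pq _ _ (CL_ef S p q CX Xe Xe')).
  by case: ifP; rewrite ?star_morphism0.
- rewrite -(pq _ _ (CL_sum p q SX vX)) star_morphism_fsum//.
    by apply: eq_fsbigr => e _; rewrite fM fS.
  by have [] := Sfin SX.
Qed.

Let V := @CLab_vertex K E S.
Let D := @CLab_edge K E S.
Let piab := quot_pi_morphism (CLab_ideal K S).
Let pi := quot_pi_morphism (CL_ideal K S).

Lemma CLab_relP a b : CL_rel S V D a b -> a = b.
Proof.
apply: (CL_rel_morphism piab) => {}a {}b ab; congr quot_pi.
by apply: (CL_rel_morphism pi _ ab); exact: CL_relP.
Qed.

Lemma CLab_tame x y :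
  star_semigroup_gen (range V `|` range D) x ->
  star_semigroup_gen (range V `|` range D) y ->
  commutator (x ** x^* ) (y ** y^* ) = 0.
Proof.
have gen_lift h : (range V `|` range D) h -> exists2 g,
    (range (@CL_vertex K E S) `|` range (@CL_edge K E S)) g &
    quot_pi (CLab_ideal K S) g = h.
  case=> -[z _ <-].
    by exists (CL_vertex K S z) => //; left; exists z.
  by exists (CL_edge K S z) => //; right; exists z.
move=> /(star_semigroup_gen_lift piab gen_lift)[x' Gx <-].
move=> /(star_semigroup_gen_lift piab gen_lift)[y' Gy <-].
have [_ fM fS] := piab.
rewrite -!fS -!fM -star_morphism_commutator// -(star_morphism0 piab).
apply/quot_piP; rewrite subr0; apply: sub_gen_smallest.
by exists x' => //; exists y'.
Qed.

(** Every element is the class of a term in the generators, so this is induction on terms. *)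
Lemma CLab_ind (M : set (CLab K S)) : submodule M -> star_subsemigroup M ->
  (forall v, M (V v)) -> (forall e, M (D e)) -> forall x, M x.
Proof.
move=> [M0 ML] [MM MS] MV MD; elim/quotW; elim/quotW; elim/freeW.
pose f x := quot_pi (CLab_ideal K S) (quot_pi (CL_ideal K S) x).
have fm : star_morphism f := star_morphism_comp pi piab.
have [fL fM fS] := fm.
have DE a b : free_pi a + free_pi b = free_pi (SAdd a b) :> free K _.
  exact: free_piD.
have ZE k a : k *: free_pi a = free_pi (SScale k a) :> free K _.
  exact: free_piZ.
have ME a b : free_pi a ** free_pi b = free_pi (SMul a b) :> free K _.
  exact: free_piM.
have SE a : (free_pi a)^* = free_pi (SStar a) :> free K _ by exact: free_piS.
elim=> [[v|e]||a iha b ihb|k a iha|a iha b ihb|a iha].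
- exact: MV.
- exact: MD.
- by rewrite -[X in M X]/(f 0) star_morphism0.
- rewrite -DE -[X in M X]/(f _) star_morphismD// -[f (free_pi a)]scale1r.
  exact: ML.
- rewrite -ZE -[X in M X]/(f _) -[_ *: _]addr0 fL star_morphism0//.
  exact: ML.
- by rewrite -ME -[X in M X]/(f _) fM; apply: MM.
- by rewrite -SE -[X in M X]/(f _) fS; apply: MS.
Qed.

Lemma CLab_lift (B : starAlgType K) (p : vertex E -> B) (q : edge E -> B) :
  (forall a b, CL_rel S p q a b -> a = b) ->
  (forall x y, star_semigroup_gen (range p `|` range q) x ->
     star_semigroup_gen (range p `|` range q) y ->
     commutator (x ** x^* ) (y ** y^* ) = 0) ->
  exists f : CLab K S -> B, [/\ star_morphism f,
    forall v, f (V v) = p v & forall e, f (D e) = q e].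
Proof.
move=> pq tame; have [f [[fm fv fe] _]] := CL_universal Sfin pq.
have [_ fM fS] := fm.
have gen_f x : star_semigroup_gen
    (range (@CL_vertex K E S) `|` range (@CL_edge K E S)) x ->
    star_semigroup_gen (range p `|` range q) (f x).
  apply: star_semigroup_gen_morphism => // g [] [z _ <-].
    by rewrite fv; left; exists z.
  by rewrite fe; right; exists z.
have [|g [gm gf]] := @quot_lift K _ B (CLab_ideal K S) f fm; last first.
  by exists g; split=> // z; rewrite gf.
move=> x Ix; apply: (Ix [set x | f x = 0]); split=> [|_ [a Ga [b Gb <-]]] /=.
  have [fL _ _] := fm; split; first split=> /=.
  - exact: star_morphism0.
  - by move=> k y z /= y0 z0; rewrite fL y0 z0 scaler0 addr0.
  - by move=> a y /= y0; rewrite fM y0 smul0r.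
  - by move=> a y /= y0; rewrite fM y0 smul0l.
by rewrite star_morphism_commutator// !fM !fS tame//; exact: gen_f.
Qed.

End Relations.

(** * The commutative span of the ranges and its normalizer *)

Section TameNormalizer.
Variables (K : comStarRingType) (A : starAlgType K) (G : set A).
Hypothesis G_tame : forall x y, star_semigroup_gen G x ->
  star_semigroup_gen G y -> commutator (x ** x^* ) (y ** y^* ) = 0.
Hypothesis G_pisom : forall g, G g -> g ** g^* ** g = g.

Let U := star_semigroup_gen G.

Lemma star_semigroup_gen_subsemigroup : star_subsemigroup U.
Proof.
split=> [x y Ux Uy|x Ux] N NG; have [[NM NS] _] := NG.
  by apply: NM; [apply: Ux|apply: Uy].
by apply: NS; apply: Ux.
Qed.

Let UM := star_semigroup_gen_subsemigroup.1.
Let US := star_semigroup_gen_subsemigroup.2.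

Lemma tame_rangeC x y : U x -> U y ->
  x ** x^* ** (y ** y^* ) = y ** y^* ** (x ** x^* ).
Proof. by move=> Ux Uy; apply/eqP; rewrite -subr_eq0; apply/eqP/G_tame. Qed.

(** A product x y of partial isometries is again one when x^* x and y y^* commute, which is tameness
    applied to x^* and y. *)
Lemma tame_pisom u : U u -> u ** u^* ** u = u.
Proof.
(* Membership in [U] is carried along, since tameness speaks only of words. *)
move=> Uu; suff [] : U u /\ u ** u^* ** u = u by [].
apply: (Uu [set u | U u /\ u ** u^* ** u = u]).
split=> [|g Gg] /=; last by split; [exact: sub_gen_smallest|exact: G_pisom].
split=> [x y [Ux xP] [Uy yP]|x [Ux xP]] /=; last first.
  by split; [exact: US|rewrite -[in RHS]xP !starM smulA].
split; first exact: UM.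
have /= := tame_rangeC Uy (US Ux); rewrite starK => xyC.
rewrite starM !smulA.
have -> : x ** y ** y^* ** x^* ** x ** y = x ** (y ** y^* ** (x^* ** x)) ** y.
  by rewrite !smulA.
by rewrite xyC !smulA xP -!smulA [y ** _]smulA yP.
Qed.

Definition range_span : set A := span [set u ** u^* | u in U].

Let D := range_span.
Let D0 := (span_submodule [set u ** u^* | u in U]).1.
Let DL := (span_submodule [set u ** u^* | u in U]).2.

Lemma range_span_gen u : U u -> D (u ** u^* ).
Proof. by move=> Uu; apply: sub_gen_smallest; exists u. Qed.

Lemma range_spanB x y : D x -> D y -> D (x - y).
Proof. by move=> Dx Dy; rewrite addrC -scaleN1r; apply: DL. Qed.

Lemma range_span_conj u d : U u -> D d -> D (u ** d ** u^* ).
Proof.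
move=> Uu Dd; apply: (Dd [set d | D (u ** d ** u^* )]).
split=> [|_ [w Uw <-]] /=.
  split=> [|k x y Dx Dy] /=; first by rewrite smul0r smul0l.
  by rewrite smulDr smulDl smulZr smulZl; apply: DL.
have -> : u ** (w ** w^* ) ** u^* = u ** w ** (u ** w)^*.
  by rewrite starM !smulA.
by apply: range_span_gen; apply: UM.
Qed.

Lemma range_spanC x y : D x -> D y -> x ** y = y ** x.
Proof.
move=> Dx Dy; apply: (Dx [set x | x ** y = y ** x]).
split=> [|_ [u Uu <-]] /=.
  split=> [|k a b ax bx] /=; first by rewrite smul0l smul0r.
  by rewrite smulDl smulDr smulZl smulZr ax bx.
apply: (Dy [set y | u ** u^* ** y = y ** (u ** u^* )]).
split=> [|_ [w Uw <-]] /=; last exact: tame_rangeC.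
split=> [|k a b ax bx] /=; first by rewrite smul0l smul0r.
by rewrite smulDl smulDr smulZl smulZr ax bx.
Qed.

(** Since y commutes with u u^* and u u^* u = u, the product u u^* y equals u (u^* y u) u^*, a
    twofold conjugate of y. *)
Lemma range_spanM x y : D x -> D y -> D (x ** y).
Proof.
move=> Dx Dy; apply: (Dx [set x | D (x ** y)]).
split=> [|_ [u Uu <-]] /=.
  split=> [|k a b Da Db] /=; first by rewrite smul0l.
  by rewrite smulDl smulZl; apply: DL.
have Duu := range_span_gen Uu.
have -> : u ** u^* ** y = u ** (u^* ** y ** u) ** u^*.
  have -> : u ** (u^* ** y ** u) ** u^* = u ** u^* ** (y ** (u ** u^* )).
    by rewrite !smulA.
  by rewrite (range_spanC Dy Duu) !smulA tame_pisom.
apply: range_span_conj => //; rewrite -[u in _ ** u]starK.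
by apply: range_span_conj => //; exact: US.
Qed.

(* Elements such as [v - \sum_(e in X) e e^*], which lie in the span of the   *)
(* ranges but not in the semigroup, normalize that span as well, so adding    *)
(* them to the generators preserves tameness.                                 *)
Definition range_normalizer : set A :=
  [set x | [/\ D (x ** x^* ), D (x^* ** x),
    forall d, D d -> D (x ** d ** x^* ) & forall d, D d -> D (x^* ** d ** x)]].

Lemma range_normalizer_subsemigroup : star_subsemigroup range_normalizer.
Proof.
split=> [x y [x1 x2 x3 x4] [y1 y2 y3 y4]|x [x1 x2 x3 x4]]; last first.
  by split; rewrite ?starK.
split; rewrite starM.
- by have := x3 _ y1; rewrite !smulA.
- by have := y4 _ x2; rewrite !smulA.
- by move=> d /y3/x3; rewrite !smulA.
- by move=> d /x4/y4; rewrite !smulA.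
Qed.

Lemma range_normalizer_gen u : U u -> range_normalizer u.
Proof.
move=> Uu; have USu := US Uu; split.
- exact: range_span_gen.
- by have := range_span_gen USu; rewrite starK.
- by move=> d; exact: range_span_conj.
- by move=> d /(range_span_conj USu); rewrite starK.
Qed.

Lemma range_normalizer_span d : D d -> d^* = d -> range_normalizer d.
Proof.
by move=> Dd dS; split; rewrite dS => *; do ?apply: range_spanM.
Qed.

Lemma range_normalizer_tame x y : range_normalizer x -> range_normalizer y ->
  commutator (x ** x^* ) (y ** y^* ) = 0.
Proof.
by move=> [Dx _ _ _] [Dy _ _ _]; rewrite /commutator (range_spanC Dx Dy) subrr.
Qed.

End TameNormalizer.

(** * A star-algebra of operators without an inner product *)

Section OperatorPairs.
Variables (K : comStarRingType) (H : lmodType K).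

Definition linop_pred : {pred H -> H} := fun T => `[< linear T >].

Lemma linop_predP T : reflect (linear T) (T \in linop_pred).
Proof. exact: asboolP. Qed.

Lemma linop_submod_closed : submod_closed linop_pred.
Proof.
split=> [|k T T' /linop_predP TL /linop_predP TL']; apply/linop_predP => a x y.
  by rewrite scaler0 addr0.
rewrite !fctE TL TL' !scalerDr !scalerA [k * a]mulrC.
by rewrite -!addrA; congr (_ + _); rewrite addrCA.
Qed.

HB.instance Definition _ :=
  GRing.isSubmodClosed.Build K (H -> H) linop_pred linop_submod_closed.

Record linop : Type := Linop {
  linop_val : H -> H; _ : linop_val \in linop_pred
}.

HB.instance Definition _ := [isSub for linop_val].
HB.instance Definition _ := [Choice of linop by <:].
HB.instance Definition _ := [SubChoice_isSubLmodule of linop by <:].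

Lemma linopP (T : linop) : linear (val T).
Proof. by apply/linop_predP; exact: valP. Qed.

Fact linop_comp_subproof (T T' : linop) : val T \o val T' \in linop_pred.
Proof. by apply/linop_predP => k x y /=; rewrite !linopP. Qed.

Definition linop_comp (T T' : linop) : linop :=
  Linop (linop_comp_subproof T T').

Lemma linop_eq (T T' : linop) : (forall h, val T h = val T' h) -> T = T'.
Proof. by move=> TT'; apply/val_inj/funext. Qed.

Lemma linop_compDl : left_distributive linop_comp +%R.
Proof. by move=> R T T'; apply: linop_eq => h. Qed.

Lemma linop_compDr : right_distributive linop_comp +%R.
Proof.
move=> R T T'; apply: linop_eq => h /=.
by have := linopP R 1 (val T h) (val T' h); rewrite !scale1r.
Qed.

Lemma linop_compZl k T T' : linop_comp (k *: T) T' = k *: linop_comp T T'.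
Proof. by apply: linop_eq. Qed.

Lemma linop_compZr k T T' : linop_comp T (k *: T') = k *: linop_comp T T'.
Proof.
apply: linop_eq => h /=; have T0 : val T 0 = 0.
  by have := linopP T (-1) 0 0; rewrite addr0 scaler0 scaleN1r addNr.
by have := linopP T k (val T' h) 0; rewrite T0 !addr0.
Qed.

Lemma kstar1 : kstar 1 = 1 :> K.
Proof. by rewrite -[LHS]mulr1 -[X in _ * X]kstarK -kstarM mul1r kstarK. Qed.

(* [End_K(H) x End_K(H)^op], where the exchange of the two components is an   *)
(* involution.                                                                *)
Definition oppair : Type := (linop * linop)%type.
HB.instance Definition _ := GRing.Zmodule.on oppair.

(** Conjugating the scalar in the second component makes the exchange conjugate-linear. *)
Definition oppair_scale k (a : oppair) : oppair := (k *: a.1, kstar k *: a.2).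
Definition oppair_mul (a b : oppair) : oppair :=
  (linop_comp a.1 b.1, linop_comp b.2 a.2).
Definition oppair_star (a : oppair) : oppair := (a.2, a.1).

Fact oppair_scalerA k l a :
  oppair_scale k (oppair_scale l a) = oppair_scale (k * l) a.
Proof. by rewrite /oppair_scale /= kstarM !scalerA. Qed.
Fact oppair_scale1r : left_id 1 oppair_scale.
Proof. by case=> a b; rewrite /oppair_scale /= kstar1 !scale1r. Qed.
Fact oppair_scalerDr : right_distributive oppair_scale +%R.
Proof. by move=> k a b; rewrite /oppair_scale /= !scalerDr. Qed.
Fact oppair_scalerDl a : {morph oppair_scale^~ a : k l / k + l}.
Proof. by move=> k l; rewrite /oppair_scale /= kstarD !scalerDl. Qed.

HB.instance Definition _ := GRing.Zmodule_isLmodule.Build K oppair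
  oppair_scalerA oppair_scale1r oppair_scalerDr oppair_scalerDl.

Fact oppair_mulA : associative oppair_mul.
Proof. by move=> a b c; congr pair; exact: linop_eq. Qed.
Fact oppair_mulDl : left_distributive oppair_mul +%R.
Proof.
by move=> a b c; congr pair; [exact: linop_compDl|exact: linop_compDr].
Qed.
Fact oppair_mulDr : right_distributive oppair_mul +%R.
Proof.
by move=> a b c; congr pair; [exact: linop_compDr|exact: linop_compDl].
Qed.
Fact oppair_mulZl k a b : oppair_mul (k *: a) b = k *: oppair_mul a b.
Proof. by congr pair; [exact: linop_compZl|exact: linop_compZr]. Qed.
Fact oppair_mulZr k a b : oppair_mul a (k *: b) = k *: oppair_mul a b.
Proof. by congr pair; [exact: linop_compZr|exact: linop_compZl]. Qed.
Fact oppair_starD : {morph oppair_star : a b / a + b}.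
Proof. by []. Qed.
Fact oppair_starZ k a : oppair_star (k *: a) = kstar k *: oppair_star a.
Proof. by congr pair; rewrite /= kstarK. Qed.
Fact oppair_starM a b :
  oppair_star (oppair_mul a b) = oppair_mul (oppair_star b) (oppair_star a).
Proof. by []. Qed.
Fact oppair_starK : involutive oppair_star.
Proof. by case. Qed.

HB.instance Definition _ := Lmodule_isStarAlgebra.Build K oppair
  oppair_mulA oppair_mulDl oppair_mulDr oppair_mulZl oppair_mulZr
  oppair_starD oppair_starZ oppair_starM oppair_starK.

End OperatorPairs.

(** * Matrix units over an algebra without unit *)

Section MatrixUnits.
Variables (K : comStarRingType) (A : starAlgType K) (I : eqType).

(* Left multiplication on the unitization [A * K], which is faithful although *)
(* [A] has no unit.                                                           *)
Definition unitization_act (x : A) (u : A * K^o) : A * K^o :=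
  (x ** u.1 + (u.2 : K) *: x, 0).

Lemma unitization_act_linear x : linear (unitization_act x).
Proof.
move=> k u w; rewrite /unitization_act; apply/pair_equal_spec; split => /=.
  by rewrite smulDr smulZr !scalerDl !scalerDr scalerA addrACA.
by rewrite scaler0 addr0.
Qed.

Lemma unitization_act0 x : unitization_act x 0 = 0.
Proof. by rewrite /unitization_act /= smul0r scale0r addr0. Qed.

Lemma unitization_actL k x y u :
  unitization_act (k *: x + y) u =
  k *: unitization_act x u + unitization_act y u.
Proof.
apply/pair_equal_spec; split => /=; last by rewrite scaler0 addr0.
by rewrite smulDl smulZl !scalerDr !scalerA [_ * k]mulrC addrACA.
Qed.

Lemma unitization_actM x y u :
  unitization_act (x ** y) u = unitization_act x (unitization_act y u).
Proof.
by rewrite /unitization_act /= smulDr smulZr smulA scale0r addr0.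
Qed.

Local Notation H := (I -> A * K^o).

Definition matop_fun (i j : I) (x : A) (h : H) : H :=
  fun k => if k == i then unitization_act x (h j) else 0.

Fact matop_subproof i j x : matop_fun i j x \in @linop_pred K H.
Proof.
apply/linop_predP => k h h'; apply/funext => l; rewrite /matop_fun !fctE.
by case: ifP => _; [exact: unitization_act_linear|rewrite scaler0 addr0].
Qed.

Definition matop i j x : linop H := Linop (matop_subproof i j x).

(** The second component is the adjoint matrix, so that exchanging components is the usual star of
    matrices. *)
Definition matunit i j (x : A) : oppair H := (matop i j x, matop j i x^* ).

Lemma matop_linear i j : linear (matop i j).
Proof.
move=> k x y; apply: linop_eq => h; apply/funext => l.
rewrite /= !fctE /matop_fun; case: ifP => _; first exact: unitization_actL.
by rewrite scaler0 addr0.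
Qed.

Lemma matunit_linear i j : linear (matunit i j).
Proof.
move=> k x y; apply/pair_equal_spec; split; first exact: matop_linear.
by rewrite starD starZ; exact: matop_linear.
Qed.

Lemma matunitB i j x y : matunit i j (x - y) = matunit i j x - matunit i j y.
Proof. by rewrite [x - y]addrC -scaleN1r matunit_linear scaleN1r addrC. Qed.

Lemma matunit0 i j : matunit i j 0 = 0.
Proof. by rewrite -(subrr 0) matunitB subrr. Qed.

Lemma matunitS i j x : (matunit i j x)^* = matunit j i x^*.
Proof. by rewrite /matunit starK. Qed.

Lemma matopM i j k l x y : linop_comp (matop i j x) (matop k l y) =
  if j == k then matop i l (x ** y) else 0.
Proof.
apply: linop_eq => h; apply/funext => n /=; rewrite /matop_fun.
case: (eqVneq j k) => [_|_] /=; rewrite /matop_fun; case: ifP => // _.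
  by rewrite unitization_actM.
by rewrite unitization_act0.
Qed.

Lemma matunitM i j k l x y : matunit i j x ** matunit k l y =
  if j == k then matunit i l (x ** y) else 0.
Proof.
rewrite -[LHS]/(linop_comp _ _, linop_comp _ _) /= !matopM [k == j]eq_sym.
by case: eqP => // _; rewrite /matunit starM.
Qed.

(** Applied to the constant family (0, 1), the unit of the unitization, the operator returns x at
    index i. *)
Lemma matunit_inj i j : injective (matunit i j).
Proof.
move=> x y /(congr1 (fun a : oppair H => (val a.1 (fun=> (0, 1)) i).1)) /=.
by rewrite /matop_fun eqxx /= !smul0r !add0r !scale1r.
Qed.

Lemma matunit_morphism i : star_morphism (matunit i i).
Proof.
split=> [|x y|x]; first exact: matunit_linear.
  by rewrite matunitM eqxx.
by rewrite matunitS.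
Qed.

End MatrixUnits.

(** * Finite sums and the gap projections *)

Section StarAlgebraSums.
Variables (K : comStarRingType) (A : starAlgType K) (T : choiceType).
Implicit Types (X : set T) (F : T -> A).

Lemma smul_fsumr X F x : finite_set X ->
  x ** (\sum_(t \in X) F t) = \sum_(t \in X) (x ** F t).
Proof.
move=> Xfin; rewrite !fsbig_finite//.
by apply: (big_morph (smul x)); [exact: smulDr|exact: smul0r].
Qed.

Lemma smul_fsuml X F x : finite_set X ->
  (\sum_(t \in X) F t) ** x = \sum_(t \in X) (F t ** x).
Proof.
move=> Xfin; rewrite !fsbig_finite//.
by apply: (big_morph (smul^~ x)) => [y z|]; [exact: smulDl|exact: smul0l].
Qed.

Lemma star_fsum X F : finite_set X ->
  (\sum_(t \in X) F t)^* = \sum_(t \in X) (F t)^*.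
Proof.
move=> Xfin; rewrite !fsbig_finite//.
by apply: (big_morph (@star K A)) => [y z|]; [exact: starD|exact: star0].
Qed.

End StarAlgebraSums.

Section Gap.
Variables (K : comStarRingType) (E : sepGraph) (S : set (set (edge E))).
Variables (A : starAlgType K) (p : vertex E -> A) (q : edge E -> A).
Hypothesis pq : forall a b, CL_rel S p q a b -> a = b.

Definition gap (v : vertex E) (X : set (edge E)) : A :=
  p v - \sum_(e \in X) (q e ** (q e)^* ).

Variables (v : vertex E) (X : set (edge E)).
Hypotheses (vX : sep v X) (Xfin : finite_set X).

Lemma gap_star : (gap v X)^* = gap v X.
Proof.
rewrite starB (pq (CL_vstar S p q v)) star_fsum//; congr (_ - _).
by apply: eq_fsbigr => e _; rewrite starM starK.
Qed.

Lemma vertex_gap : p v ** gap v X = gap v X.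
Proof.
rewrite smulBr (pq (CL_vv S p q v v)) eqxx smul_fsumr//; congr (_ - _).
apply: eq_fsbigr => e /set_mem Xe.
by rewrite smulA -(sep_src vX Xe) (pq (CL_se S p q e)).
Qed.

Lemma gap_vertex : gap v X ** p v = gap v X.
Proof. by rewrite -gap_star -{2}vertex_gap starM (pq (CL_vstar S p q v)). Qed.

(** In the product of e^* with the sum of the f f^* only f = e survives, and it cancels e^* v =
    e^*. *)
Lemma edge_gap e : X e -> (q e)^* ** gap v X = 0.
Proof.
move=> Xe; rewrite smulBr -{1}(sep_src vX Xe) (pq (CL_es S p q e)) smul_fsumr//.
have CX : colour X by exists v.
rewrite (fsbigD1 e)//=.
rewrite smulA (pq (CL_ef S p q CX Xe Xe)) eqxx (pq (CL_re S p q e)) fsbig1.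
  by rewrite addr0 subrr.
move=> f [Xf /eqP fe]; rewrite smulA (pq (CL_ef S p q CX Xe Xf)).
by rewrite eq_sym (negbTE fe) smul0l.
Qed.

Lemma gap_edge e : X e -> gap v X ** q e = 0.
Proof. by move=> Xe; rewrite -[LHS]starK starM gap_star edge_gap// star0. Qed.

Lemma gapM : gap v X ** gap v X = gap v X.
Proof.
rewrite {1}/gap smulBl vertex_gap smul_fsuml// fsbig1 ?subr0// => e Xe.
by rewrite -smulA edge_gap// smul0r.
Qed.

End Gap.

(** * Sums over the colours of E_S *)

Section ESBar.
Variables (E : sepGraph) (S : set (set (edge E))) (V : zmodType).
Local Notation newX := (set_type (colour_fin `\` S)).

Lemma newX_finite (Y : newX) : finite_set (val Y).
Proof. by have [[]] := set_mem (valP Y). Qed.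

Lemma newX_notin (Y : newX) : ~ S (val Y).
Proof. by have [] := set_mem (valP Y). Qed.

Lemma fsum_ES_bar_old (X : set (edge E)) (F : edge E + newX -> V) : S X ->
  \sum_(e \in @ES_bar E S X) F e = \sum_(e \in X) F (inl e).
Proof.
move=> SX; rewrite /ES_bar [[set Y : newX | _]](_ : _ = set0); last first.
  apply/seteqP; split=> // Y YX.
  by case: (newX_notin (Y := Y)); rewrite (YX : val Y = X).
by rewrite image_set0 setU0 fsbig_image// => e f _ _ [].
Qed.

Lemma fsum_ES_bar_new (Y : newX) (F : edge E + newX -> V) :
  \sum_(e \in @ES_bar E S (val Y)) F e =
  \sum_(e \in val Y) F (inl e) + F (inr Y).
Proof.
rewrite /ES_bar [[set Z : newX | _]](_ : _ = [set Y]); last first.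
  by apply/seteqP; split=> [Z /= /val_inj|Z ->].
rewrite image_set1 fsbigU//=; last by move=> e [[f _ <-]].
  by rewrite fsbig_set1 fsbig_image// => e f _ _ [].
exact/finite_image/newX_finite.
Qed.

End ESBar.

(** * The canonical map into the Leavitt algebra of E_S *)

Section Main.
Variables (K : comStarRingType) (E : sepGraph) (S : set (set (edge E))).
Hypothesis Sfin : S `<=` colour_fin.

Local Notation newX := (set_type (colour_fin `\` S)).
Local Notation A := (CLab K S).
Local Notation L := (leavitt_ab K (ES S)).

Let V : vertex E -> A := @CLab_vertex K E S.
Let D : edge E -> A := @CLab_edge K E S.
Let V' : vertex (ES S) -> L := @CLab_vertex K (ES S) colour_fin.
Let D' : edge (ES S) -> L := @CLab_edge K (ES S) colour_fin.

Let rel a b : CL_rel S V D a b -> a = b.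
Proof. exact: CLab_relP. Qed.

Let rel' a b : CL_rel colour_fin V' D' a b -> a = b.
Proof. exact: CLab_relP. Qed.

(** The sum relation is demanded only for X in S, where [ES_bar X] contains no new edge; it is then
    the Leavitt relation of E_S at that finite colour. *)
Lemma ES_rel a b :
  CL_rel S (fun v => V' (inl v)) (fun e => D' (inl e)) a b -> a = b.
Proof.
case=> [v w|v|e|e|e|e|X e f CX Xe Xf|v X SX vX] /=.
- exact: (rel' (CL_vv _ _ _ (inl v : vertex (ES S)) (inl w))).
- exact: (rel' (CL_vstar _ _ _ (inl v : vertex (ES S)))).
- exact: (rel' (CL_se _ _ _ (inl e : edge (ES S)))).
- exact: (rel' (CL_er _ _ _ (inl e : edge (ES S)))).
- exact: (rel' (CL_es _ _ _ (inl e : edge (ES S)))).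
- exact: (rel' (CL_re _ _ _ (inl e : edge (ES S)))).
- have CX' : @colour (ES S) (@ES_bar E S X).
    by have [v _ vX] := CX; exists (inl v) => //; exists X.
  by apply: (rel' (CL_ef _ _ _ CX' _ _)); left; [exists e|exists f].
- have vX' : @sep (ES S) (inl v) (@ES_bar E S X) by exists X.
  rewrite -(fsum_ES_bar_old (fun e => D' e ** (D' e)^* ) SX).
  apply: (rel' (CL_sum _ _ _ vX')); split; first by exists (inl v).
  rewrite /= /ES_bar finite_setU; split; first exact/finite_image/(Sfin SX).2.
  apply/finite_image/(sub_finite_set _ (finite_set0 _)) => Y YX.
  by case: (newX_notin (Y := Y)); rewrite (YX : val Y = X).
Qed.

Lemma CLab_to_ES : exists phi : A -> L, [/\ star_morphism phi,
  forall v, phi (V v) = V' (inl v) & forall e, phi (D e) = D' (inl e)].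
Proof.
(* The identity morphism gives monotonicity of [star_semigroup_gen] in its generators. *)
have id_m : star_morphism (id : L -> L) by [].
have sub g : (range (fun v => V' (inl v)) `|` range (fun e => D' (inl e))) g ->
    (range V' `|` range D') g.
  by case=> -[z _ <-]; [left|right]; exists (inl z).
apply: (CLab_lift Sfin ES_rel) => x y Gx Gy.
by apply: CLab_tame => //; apply: (star_semigroup_gen_morphism id_m sub).
Qed.

(** * The matrix representation and injectivity *)

(** [None] is the index of the old graph, [Some X] that of the new vertex v_X. *)
Let I := option newX.
Let B := oppair (I -> A * K^o).
Let unit (i j : I) (x : A) : B := matunit i j x.
Let g (X : newX) : A := gap V D (colour_src X) (val X).

Let um : star_morphism (unit None None).
Proof. exact: matunit_morphism. Qed.

Let gS X : (g X)^* = g X.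
Proof. exact: (gap_star rel _ (newX_finite X)). Qed.

Let gM X : g X ** g X = g X.
Proof. exact: (gapM rel (colour_srcP X) (newX_finite X)). Qed.

Let Vg X : V (colour_src X) ** g X = g X.
Proof. exact: (vertex_gap rel (colour_srcP X) (newX_finite X)). Qed.

Let gV X : g X ** V (colour_src X) = g X.
Proof. exact: (gap_vertex rel (colour_srcP X) (newX_finite X)). Qed.

Let Dg X e : val X e -> (D e)^* ** g X = 0.
Proof. exact: (edge_gap rel (colour_srcP X) (newX_finite X)). Qed.

Let gD X e : val X e -> g X ** D e = 0.
Proof. exact: (gap_edge rel (colour_srcP X) (newX_finite X)). Qed.

(* The matrix picture of the linking algebra: the new vertex [v_X] is the gap *)
(* projection of [X], moved to its own diagonal position.                     *)
Definition ES_vertex_matrix (v : vertex (ES S)) : B :=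
  match v with
  | inl v => unit None None (V v)
  | inr X => unit (Some X) (Some X) (g X)
  end.

Definition ES_edge_matrix (e : edge (ES S)) : B :=
  match e with
  | inl e => unit None None (D e)
  | inr X => unit None (Some X) (g X)
  end.

Lemma ES_matrix_rel a b :
  CL_rel colour_fin ES_vertex_matrix ES_edge_matrix a b -> a = b.
Proof.
case=> [v w|v|e|e|e|e|X e f CX Xe Xf|v X SX vX].
- case: v w => [v|X] [w|Y] /=; rewrite /unit matunitM //=.
    rewrite (rel (CL_vv _ _ _ v w)) -[inl v == inl w]/(v == w).
    by case: eqP => // _; rewrite matunit0.
  rewrite -[Some X == Some Y]/(X == Y) -[inr X == inr Y]/(X == Y).
  by case: eqP => // ->; rewrite gM.
- case: v => [v|X] /=; rewrite /unit matunitS ?gS//.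
  by rewrite (rel (CL_vstar _ _ _ v)).
- case: e => [e|X] /=; rewrite /unit matunitM /= ?Vg//.
  by rewrite (rel (CL_se _ _ _ e)).
- case: e => [e|X] /=; rewrite /unit matunitM ?eqxx /= ?gM//.
  by rewrite (rel (CL_er _ _ _ e)).
- case: e => [e|X] /=; rewrite /unit matunitS matunitM /= ?gS ?gV//.
  by rewrite (rel (CL_es _ _ _ e)).
- case: e => [e|X] /=; rewrite /unit matunitS matunitM ?eqxx /= ?gS ?gM//.
  by rewrite (rel (CL_re _ _ _ e)).
- case: CX Xe Xf => -[v|//] _ [X0 vX0 <-].
  have CX0 : colour X0 by exists v.
  (* Two old edges obey the relation of A, mixed pairs vanish because the gap is orthogonal to the
     edges of X0, and two new edges of one colour coincide. *)
  case=> [[e0 Xe0 <-]|[Y YX <-]] [[f0 Xf0 <-]|[Z ZX <-]] /=;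
    rewrite /unit matunitS matunitM /=.
  + rewrite (rel (CL_ef _ _ _ CX0 Xe0 Xf0)) -[inl e0 == inl f0]/(e0 == f0).
    by case: eqP => // _; rewrite matunit0.
  + by rewrite Dg ?matunit0// (ZX : val Z = X0).
  + by rewrite gS gD ?matunit0// (YX : val Y = X0).
  + have -> : Z = Y by apply: val_inj; rewrite (YX : val Y = X0).
    by rewrite !eqxx gS gM.
- case: v vX SX => [v|//] [X0 vX0 <-] [_ /= Xfin].
  have X0fin : finite_set X0.
    apply: sub_finite_set
      (@finite_preimage _ _ _ (inl : _ -> edge E + newX) _ Xfin).
      by move=> e Xe; left; exists e.
    by move=> ? ? _ _ [].
  (* For X0 in S this is the sum relation of A; otherwise the extra summand from d_X is the gap,
     which completes the sum to v. *)
  have [SX|SX] := pselect (S X0).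
    rewrite fsum_ES_bar_old//= -(rel (CL_sum _ _ SX vX0)).
    rewrite (star_morphism_fsum um)//.
    by apply: eq_fsbigr => e _; rewrite /unit matunitS matunitM.
  have newX0 : X0 \in colour_fin `\` S.
    by apply/mem_set; split=> //; split=> //; exists v.
  pose Y : newX := SigSub newX0.
  rewrite -[X0]/(val Y) fsum_ES_bar_new /= /unit matunitS matunitM eqxx gS gM.
  rewrite -[RHS]/(unit None None (V v)).
  have -> : v = colour_src Y by apply: sep_inj vX0 (colour_srcP Y).
  rewrite -[V _](subrK (\sum_(e \in val Y) (D e ** (D e)^* ))).
  rewrite (star_morphismD um) (star_morphism_fsum um)//.
  rewrite [RHS]addrC; congr (_ + _).
  by apply: eq_fsbigr => e _; rewrite matunitS matunitM.
Qed.

Let G := range V `|` range D.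

Let G_tame x y : star_semigroup_gen G x -> star_semigroup_gen G y ->
  commutator (x ** x^* ) (y ** y^* ) = 0.
Proof. exact: CLab_tame. Qed.

Let G_pisom x : G x -> x ** x^* ** x = x.
Proof.
case=> -[z _ <-].
  by rewrite (rel (CL_vstar _ _ _ z)) !(rel (CL_vv _ _ _ z z)) eqxx
    (rel (CL_vv _ _ _ z z)) eqxx.
have [cE _ _] := sepP (src z).
have : (src @^-1` [set src z]) z by [].
rewrite -cE => -[X vX /= Xz].
have CX : colour X by exists (src z).
by rewrite -smulA (rel (CL_ef _ _ _ CX Xz Xz)) eqxx (rel (CL_er _ _ _ z)).
Qed.

(** The gap is a self-adjoint combination of the ranges v v^* and e e^* of generators. *)
Lemma gap_normalizer X : range_normalizer G (g X).
Proof.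
apply: range_normalizer_span => //.
apply: range_spanB.
  have := range_span_gen (G := G) (u := V (colour_src X)).
  rewrite (rel (CL_vstar _ _ _ _)) (rel (CL_vv _ _ _ _ _)) eqxx; apply.
  by apply: sub_gen_smallest; left; exists (colour_src X).
have [N0 NL] := span_submodule [set u ** u^* | u in star_semigroup_gen G].
rewrite fsbig_finite; last exact: newX_finite.
apply: (big_ind (range_span G)) => // [x y Nx Ny|e _].
  by rewrite -[x]scale1r; apply: NL.
by apply: range_span_gen; apply: sub_gen_smallest; right; exists e.
Qed.

(** Every word is a matrix unit with entry in the normalizer. Its range is a diagonal unit, and two
    of these commute: at equal indices by [range_normalizer_tame], at different ones because both
    products vanish. *)
Lemma ES_matrix_tame x y :
  star_semigroup_gen (range ES_vertex_matrix `|` range ES_edge_matrix) x ->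
  star_semigroup_gen (range ES_vertex_matrix `|` range ES_edge_matrix) y ->
  commutator (x ** x^* ) (y ** y^* ) = 0.
Proof.
pose M : set B :=
  [set x | exists i j a, range_normalizer G a /\ x = unit i j a].
have [NM NS] := range_normalizer_subsemigroup G.
have GN a : G a -> range_normalizer G a.
  by move=> Ga; apply: range_normalizer_gen => //; exact: sub_gen_smallest.
(* A product of mismatched matrix units is zero and is recorded in [M] with entry 0. *)
have N0 : range_normalizer G 0.
  have [D0 _] := span_submodule [set u ** u^* | u in star_semigroup_gen G].
  by apply: range_normalizer_span => //; exact: star0.
have genM z :
    star_semigroup_gen (range ES_vertex_matrix `|` range ES_edge_matrix) z ->
    M z.
  move=> Gz; apply: Gz; split; first split.
  - move=> _ _ [i [j [a [Na ->]]]] [k [l [b [Nb ->]]]].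
    exists i, l, (if j == k then a ** b else 0); rewrite /unit matunitM.
    by case: eqP => _; rewrite ?matunit0; split=> //; exact: NM.
  - by move=> _ [i [j [a [Na ->]]]]; exists j, i, a^*; rewrite /unit matunitS;
      split=> //; exact: NS.
  - move=> _ [] [] [t|X] _ <-.
    + by exists None, None, (V t); split=> //; apply: GN; left; exists t.
    + by exists (Some X), (Some X), (g X); split=> //; exact: gap_normalizer.
    + by exists None, None, (D t); split=> //; apply: GN; right; exists t.
    + by exists None, (Some X), (g X); split=> //; exact: gap_normalizer.
move=> /genM[i [j [a [Na ->]]]] /genM[k [l [b [Nb ->]]]].
rewrite /commutator /unit !matunitS !matunitM !eqxx !matunitM [k == i]eq_sym.
case: eqP => [->|_]; last by rewrite subrr.
rewrite -matunitB -/(commutator _ _) (range_normalizer_tame _ Na Nb)//.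
exact: matunit0.
Qed.

(** The matrices induce a map [psi] on L, and [psi \o phi] agrees on generators with the injective
    map [unit None None]. *)
Lemma CLab_to_ES_inj (phi : A -> L) : star_morphism phi ->
  (forall v, phi (V v) = V' (inl v)) -> (forall e, phi (D e) = D' (inl e)) ->
  injective phi.
Proof.
move=> phim phiV phiD.
have [//|psi [psim psiV psiD]] := CLab_lift _ ES_matrix_rel ES_matrix_tame.
suff psiE x : psi (phi x) = unit None None x.
  by move=> x y /(congr1 psi); rewrite !psiE; exact: matunit_inj.
have [pL pM pS] := star_morphism_comp phim psim.
have [uL uM uS] := um.
apply: (CLab_ind (M := [set x | (psi \o phi) x = unit None None x])).
- split=> [|k y z /= Py Pz] /=.
    by rewrite star_morphism0// star_morphism0// star_morphism0.
  by rewrite uL -Py -Pz -pL.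
- split=> [y z /= Py Pz|y /= Py] /=; first by rewrite uM -Py -Pz -pM.
  by rewrite uS -Py -pS.
- by move=> v /=; rewrite phiV psiV.
- by move=> e /=; rewrite phiD psiD.
Qed.

(** * The image of [phi] is the corner *)

Section Surjectivity.
Variable phi : A -> L.
Hypotheses (phim : star_morphism phi) (phiV : forall v, phi (V v) = V' (inl v))
  (phiD : forall e, phi (D e) = D' (inl e)).

Let phiL := let: And3 h _ _ := phim in h.
Let phiM := let: And3 _ h _ := phim in h.
Let phiS := let: And3 _ _ h := phim in h.

(** The Leavitt relation at the colour [ES_bar (val X)] writes v as the sum of the e e^* over X plus
    d_X d_X^*. *)
Lemma phi_gap X : phi (g X) = D' (inr X) ** (D' (inr X))^*.
Proof.
have vX : @sep (ES S) (inl (colour_src X)) (@ES_bar E S (val X)).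
  by exists (val X) => //; exact: colour_srcP.
have fX : @colour_fin (ES S) (@ES_bar E S (val X)).
  split; first by exists (inl (colour_src X)).
  rewrite /= /ES_bar finite_setU; split; first exact/finite_image/newX_finite.
  apply/finite_image/(sub_finite_set _ (finite_set1 X)) => Y YX.
  exact: val_inj.
rewrite /g /gap star_morphismB// star_morphism_fsum//; last exact: newX_finite.
rewrite phiV -(rel' (CL_sum _ _ fX vX)).
rewrite (fsum_ES_bar_new X (fun e => D' e ** (D' e)^* )) /=.
set s1 := \sum_(e \in _) _; set s2 := \sum_(e \in _) _.
have -> : s2 = s1 by apply: eq_fsbigr => e _; rewrite phiM phiS phiD.
by rewrite addrC addKr.
Qed.

(* The old vertices and the new edges; every product of generators starting   *)
(* at an old vertex collapses to an image of [phi] times one of these.        *)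
Let T : set L :=
  range (fun v => V' (inl v)) `|` range (fun X => D' (inr X)).

Let N : set L := span [set y | exists x l, T l /\ y = phi x ** l].

Let N0 : N 0.
Proof.
by have [] := span_submodule [set y | exists x l, T l /\ y = phi x ** l].
Qed.

Let NL k x y : N x -> N y -> N (k *: x + y).
Proof.
have [_ h] := span_submodule [set y | exists x l, T l /\ y = phi x ** l].
exact: h.
Qed.

Let NT x l : T l -> N (phi x ** l).
Proof. by move=> Tl; apply: sub_gen_smallest; exists x, l. Qed.

Let TN l : T l -> N l.
Proof.
case=> -[z _ <-].
  rewrite -[X in N X](_ : phi (V z) ** V' (inl z) = _).
    by apply: NT; left; exists z.
  by rewrite phiV (rel' (CL_vv _ _ _ _ _)) eqxx.
rewrite -[X in N X](_ : phi (V (colour_src z)) ** D' (inr z) = _).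
  by apply: NT; right; exists z.
by rewrite phiV (rel' (CL_se _ _ _ (inr z : edge (ES S)))).
Qed.

Let NM x y : N y -> N (phi x ** y).
Proof.
move=> Ny; apply: (Ny [set y | N (phi x ** y)]).
split=> [|_ [z [l [Tl ->]]]] /=; last by rewrite smulA -phiM; exact: NT.
split=> [|k a b Na Nb] /=; first by rewrite smul0r.
by rewrite smulDr smulZr; exact: NL.
Qed.

Let T_rng l : T l -> exists u, l ** V' u = l.
Proof.
case=> -[z _ <-].
  by exists (inl z); rewrite (rel' (CL_vv _ _ _ _ _)) eqxx.
by exists (inr z); rewrite (rel' (CL_er _ _ _ (inr z : edge (ES S)))).
Qed.

Let N_T_vertex l u : T l -> N (l ** V' u).
Proof.
move=> Tl; have [w lw] := T_rng Tl.
rewrite -lw -smulA (rel' (CL_vv _ _ _ _ _)); case: ifP => _.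
  by rewrite lw; exact: TN.
by rewrite smul0r.
Qed.

Let vertex_mul0 (u w : vertex (ES S)) x y : u != w ->
  x ** V' u = x -> V' w ** y = y -> x ** y = 0.
Proof.
move=> uw <- <-; rewrite -smulA [V' u ** _]smulA (rel' (CL_vv _ _ _ _ _)).
by rewrite (negbTE uw) smul0l smul0r.
Qed.

(** New vertices emit no edge, so a new edge times any edge is zero; an old vertex returns the edge
    itself or zero. *)
Let N_T_edge l e : T l -> N (l ** D' e).
Proof.
have se := rel' (CL_se _ _ _ e).
case=> -[z _ <-]; last first.
  have er := rel' (CL_er _ _ _ (inr z : edge (ES S))).
  by rewrite (vertex_mul0 _ er se)//; case: (e).
have [<-|zs] := eqVneq (src e) (inl z); last first.
  rewrite (vertex_mul0 (u := inl z) _ _ se)// 1?eq_sym//.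
  by rewrite (rel' (CL_vv _ _ _ _ _)) eqxx.
rewrite se; case: (e) => [f|X]; last by apply: TN; right; exists X.
rewrite -(rel' (CL_er _ _ _ (inl f : edge (ES S)))) -phiD.
by apply: NT; left; exists (rng f).
Qed.

(** Only d_X ends at v_X, so the one nonzero product of a new edge with an adjoint is d_X d_X^*, the
    image of a gap. *)
Let N_T_edge_star l e : T l -> N (l ** (D' e)^* ).
Proof.
have re := rel' (CL_re _ _ _ e).
case=> -[z _ <-].
  have [ze|zr] := eqVneq (rng e) (inl z); last first.
    rewrite (vertex_mul0 (u := inl z) _ _ re)// 1?eq_sym//.
    by rewrite (rel' (CL_vv _ _ _ _ _)) eqxx.
  rewrite -ze re -(rel' (CL_es _ _ _ e)).
  case: (e) ze => [f|//] _; rewrite -phiD -phiS.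
  by apply: NT; left; exists (src f).
have er := rel' (CL_er _ _ _ (inr z : edge (ES S))).
have [ze|zr] := eqVneq (rng e) (inr z); last first.
  by rewrite (vertex_mul0 _ er re)// eq_sym.
case: (e) ze => [//|X] /= -[->].
(* The gap absorbs its vertex on the right, which supplies the factor in [T]. *)
rewrite -phi_gap -gV phiM; apply: NM; rewrite phiV.
by apply: TN; left; exists (colour_src z).
Qed.

Let N_mulr a y : (forall l, T l -> N (l ** a)) -> N y -> N (y ** a).
Proof.
move=> Ta Ny; apply: (Ny [set y | N (y ** a)]).
split=> [|_ [z [l [Tl ->]]]] /=; last by rewrite -smulA; apply: NM; apply: Ta.
split=> [|k x x' Nx Nx'] /=; first by rewrite smul0l.
by rewrite smulDl smulZl; exact: NL.
Qed.

Lemma N_T_mul a l : T l -> N (l ** a).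
Proof.
move: a l.
(* The adjoint is included because [CLab_ind] asks for a star-closed set. *)
suff Pa a : forall l, T l -> N (l ** a) /\ N (l ** a^* ).
  by move=> a l /(Pa a)[].
apply: (CLab_ind
  (M := [set a | forall l, T l -> N (l ** a) /\ N (l ** a^* )])).
- split=> [l _|k x y Nx Ny l Tl]; first by rewrite star0 smul0r.
  have [[? ?] [? ?]] := (Nx l Tl, Ny l Tl).
  by rewrite starD starZ !smulDr !smulZr; split; exact: NL.
- split=> [x y Nx Ny l Tl|x Nx l Tl]; last first.
    by have [? ?] := Nx l Tl; rewrite starK.
  have [? ?] := (Nx l Tl, Ny l Tl).
  rewrite starM !smulA; split; apply: N_mulr => //.
  + by move=> m /Ny[].
  + by case: (Nx l Tl).
  + by move=> m /Nx[].
  + by case: (Ny l Tl).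
- move=> v l Tl; rewrite (rel' (CL_vstar _ _ _ v)).
  by split; exact: N_T_vertex.
- by move=> e l Tl; split; [exact: N_T_edge|exact: N_T_edge_star].
Qed.

Lemma corner_sub_range y :
  subStarAlg_set (leavitt_corner K S) y -> exists x, phi x = y.
Proof.
move=> cy; apply: (cy [set y | exists x, phi x = y]).
have phi0 := star_morphism0 phim.
split=> [|_ [v [a [w ->]]]] /=.
  split=> [|k _ _ [x <-] [x' <-]] /=; first by exists 0.
  by exists (k *: x + x'); rewrite phiL.
have : N (V' (inl v) ** a) by apply: N_T_mul; left; exists v.
move/(_ [set y | exists x, phi x = y ** V' (inl w)]); apply.
split=> [|_ [x [l [Tl ->]]]] /=.
  split=> [|k y1 y2 [x xE] [x' x'E]] /=; first by exists 0; rewrite smul0l.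
  by exists (k *: x + x'); rewrite phiL smulDl smulZl xE x'E.
case: Tl => -[z _ <-].
  by exists (x ** (V z ** V w)); rewrite !phiM !phiV smulA.
(* A term ending in d_X has range v_X, so the old vertex w annihilates it. *)
exists 0; rewrite phi0 -smulA -(rel' (CL_er _ _ _ (inr z : edge (ES S)))).
by rewrite -smulA (rel' (CL_vv _ _ _ _ _)) !smul0r.
Qed.

Lemma phi_corner x : subStarAlg_set (leavitt_corner K S) (phi x).
Proof.
have [cM cS] := subStarAlg_semigroup (leavitt_corner K S).
have [c0 cL] := subStarAlg_submod (leavitt_corner K S).
apply: (CLab_ind (M := [set x | subStarAlg_set (leavitt_corner K S) (phi x)])).
- split=> [|k y z cy cz] /=; first by rewrite star_morphism0.
  by rewrite phiL; exact: cL.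
- split=> [y z cy cz|y cy] /=; first by rewrite phiM; exact: cM.
  by rewrite phiS; exact: cS.
- move=> v; apply: sub_gen_smallest; exists v, (V' (inl v)), v.
  by rewrite phiV !(rel' (CL_vv _ _ _ _ _)) !eqxx
    (rel' (CL_vv _ _ _ _ _)) eqxx.
- move=> e; apply: sub_gen_smallest; exists (src e), (D' (inl e)), (rng e).
  by rewrite phiD (rel' (CL_se _ _ _ (inl e : edge (ES S))))
    (rel' (CL_er _ _ _ (inl e : edge (ES S)))).
Qed.

End Surjectivity.

Lemma CLab_corner_isomorphism :
  exists phi : A -> subalg (leavitt_corner K S),
    [/\ star_isomorphism phi,
        forall v, subalg_val (phi (V v)) = V' (inl v)
      & forall e, subalg_val (phi (D e)) = D' (inl e)].
Proof.
have [phi [phim phiV phiD]] := CLab_to_ES.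
have inj := CLab_to_ES_inj phim phiV phiD.
have mem x : phi x \in subalg_pred (leavitt_corner K S).
  by apply/subalg_predP; exact: phi_corner.
have [phiL phiM phiS] := phim.
exists (fun x => Subalg (mem x)); split=> //; split.
  split=> [k x y|x y|x]; apply: val_inj => /=; first exact: phiL.
    exact: phiM.
  exact: phiS.
have surj (y : subalg (leavitt_corner K S)) : exists x, phi x = val y.
  by apply: corner_sub_range => //; apply/subalg_predP; exact: valP.
exists (fun y => sval (cid (surj y))) => [x|y].
  by apply: inj; case: cid.
by apply: val_inj => /=; case: cid.
Qed.

End Main.

Theorem theorem5p5 (K : comStarRingType) (E : sepGraph)
    (S : set (set (edge E))) (hS : S `<=` colour_fin) :
  (exists phi : CLab K S -> subalg (leavitt_corner K S),
    [/\ star_isomorphism phi,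
        forall v : vertex E,
          subalg_val (phi (CLab_vertex K S v))
            = CLab_vertex K (@colour_fin (ES S)) (inl v)
      & forall e : edge E,
          subalg_val (phi (CLab_edge K S e))
            = CLab_edge K (@colour_fin (ES S)) (inl e)]) /\
  (exists phi : cohn_ab K E -> subalg (leavitt_corner K (@set0 (set (edge E)))),
    star_isomorphism phi).
Proof.
split; first exact: CLab_corner_isomorphism.
have [phi [phiI _ _]] := @CLab_corner_isomorphism K E set0 (@sub0set _ _).
by exists phi.
Qed.
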